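(* Let $f:X\longrightarrow X$ be a continuous map on a complete metric space $(X,d)$. If any of the systems $(\mathcal{F}_\infty(X),\hat{f})$, $(\mathcal{F}_0(X),\hat{f})$ or $(\mathcal{F}_S(X),\hat{f})$ is CD-LYC, then so is $(\mathcal{K}(X),\overline{f})$ for the metric $d_H$.
   Context: Notation: $\mathbb{N}=\{1,2,3,\dots\}$, $\mathbb{I}=[0,1]$. **Cantor-dense Li-Yorke chaos.** Let $g:Y\to Y$ be a continuous map on a metric space $(Y,\rho)$. For $\varepsilon>0$, a set $S\subset Y$ is Li-Yorke $\varepsilon$-scrambled (for $g$ and $\rho$) if for every pair of distinct points $x,y\in S$ one has $\limsup_{n\to\infty}\rho(g^n(x),g^n(y))\geq\varepsilon$ and $\liminf_{n\to\infty}\rho(g^n(x),g^n(y))=0$. A Cantor set is a set homeomorphic to the classical Cantor ternary set. The system $(Y,g)$ is Cantor-densely Li-Yorke chaotic (CD-LYC) for the metric $\rho$ if there exists $\varepsilon>0$ such that for any sequence $(U_j)_{j\in\mathbb{N}}$ of non-empty open subsets of $Y$ there is a sequence of Cantor sets $(K_j)_{j\in\mathbb{N}}$ in $Y$ with $K_j\subset U_j$ for all $j\in\mathbb{N}$ and such that $\bigcup_{j\in\mathbb{N}}K_j$ is a Li-Yorke $\varepsilon$-scrambled set for $g$ and $\rho$. **Hyperspaces.** $\mathcal{K}(X)$ is the set of non-empty compact subsets of $X$. For non-empty closed sets $C_1,C_2$, $d_H(C_1,C_2):=\max\{\sup_{x_1\in C_1}\inf_{x_2\in C_2}d(x_1,x_2),\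 \sup_{x_2\in C_2}\inf_{x_1\in C_1}d(x_2,x_1)\}$ (Hausdorff metric on $\mathcal{K}(X)$). $\overline{f}:\mathcal{K}(X)\to\mathcal{K}(X)$ is $\overline{f}(K):=f(K)$. **Fuzzy sets.** $\mathcal{F}(X)$ is the set of upper-semicontinuous functions $u:X\to\mathbb{I}$ such that $u_0:=\overline{\{x: u(x)>0\}}$ is compact and $u_1\neq\varnothing$, where $u_\alpha:=\{x: u(x)\geq\alpha\}$ for $\alpha\in\,]0,1]$. The Zadeh extension $\hat{f}:\mathcal{F}(X)\to\mathcal{F}(X)$ is $[\hat{f}(u)](x):=\sup\{u(y): y\in f^{-1}(\{x\})\}$ if $f^{-1}(\{x\})\neq\varnothing$, and $0$ otherwise (it is well defined and continuous for all metrics below). Metrics on $\mathcal{F}(X)$: - $d_\infty(u,v):=\sup_{\alpha\in\mathbb{I}}d_H(u_\alpha,v_\alpha)$; - $d_0(u,v):=\inf\{\varepsilon>0:$ there is a strictly increasing homeomorphism $\xi:\mathbb{I}\to\mathbb{I}$ with $\sup_{\alpha\in\mathbb{I}}|\xi(\alpha)-\alpha|\leq\varepsilon$ and $d_\infty(u,\xi\circ v)\leq\varepsilon\}$; - on $X\times\mathbb{I}$ let $\overline{d}((x,\alpha),(y,\beta)):=\max\{d(x,y),|\alpha-\beta|\}$, and let $\operatorname{send}(u):=\{(x,\alpha)\in u_0\times\mathbb{I}: u(x)\geq\alpha\}$. Then $d_S(u,v)$ is the Hausdorff distance (induced by $\overline{d}$) between $\operatorname{send}(u)$ and $\operatorname{send}(v)$.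 $\mathcal{F}_\infty(X),\mathcal{F}_0(X),\mathcal{F}_S(X)$ denote $\mathcal{F}(X)$ with the metric $d_\infty,d_0,d_S$ respectively; chaos of these systems is meant with respect to the corresponding metric. *)

(* Defs.v *)
From HB Require Import structures.
From mathcomp Require Import all_boot all_order all_algebra.
From mathcomp Require Import all_classical all_reals all_analysis.
From mathcomp Require Import lra.

Set Implicit Arguments.
Unset Strict Implicit.
Unset Printing Implicit Defensive.

Import Order.TTheory GRing.Theory Num.Theory.
Import numFieldTopology.Exports.

Local Open Scope classical_set_scope.
Local Open Scope ring_scope.

Unset Implicit Arguments.

Definition unit_interval (R : realType) : set R := `[0, 1]%classic.

(* The n-th stage of the middle-thirds construction: [0, 1] at stage 0, and
   C_(n+1) = C_n / 3 U (2 / 3 + C_n / 3). *)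
Fixpoint cantor_stage (R : realType) (n : nat) : set R :=
  if n is m.+1 then
    [set x / 3 | x in cantor_stage R m] `|`
    [set (2 + x) / 3 | x in cantor_stage R m]
  else unit_interval R.

Definition ternary_set (R : realType) : set R := \bigcap_n cantor_stage R n.

Set Implicit Arguments.

Definition homeomorphism_between (S T : topologicalType)
    (A : set S) (B : set T) (phi : S -> T) : Prop :=
  exists psi : T -> S,
    [/\ set_fun A B phi, set_fun B A psi,
        {in A, cancel phi psi} /\ {in B, cancel psi phi},
        {within A, continuous phi} & {within B, continuous psi}].

Definition is_cantor_set (R : realType) (Y : topologicalType) (K : set Y) :=
  exists phi : R -> Y, homeomorphism_between (ternary_set R) K phi.

Definition metric_complete (R : realType) (X : metricType R) : Prop :=
  forall x : nat -> X, cauchy (x @ \oo) -> exists l : X, x @ \oo --> l.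

Section chaos.
Context {R : realType} {Y : metricType R}.

Definition scrambled (g : Y -> Y) (e : R) (S : set Y) : Prop :=
  forall x y, S x -> S y -> x <> y ->
    (e%:E <= limn_esup (fun n => (mdist (iter n g x) (iter n g y))%:E))%E /\
    limn_einf (fun n => (mdist (iter n g x) (iter n g y))%:E) = 0%E.

Definition CD_LYC (g : Y -> Y) : Prop :=
  exists2 e : R, 0 < e &
    forall U : nat -> set Y,
      (forall j, open (U j)) -> (forall j, U j !=set0) ->
      exists K : nat -> set Y,
        [/\ forall j, is_cantor_set R (K j),
            forall j, K j `<=` U j &
            scrambled g e (\bigcup_j K j)].

End chaos.

Arguments CD_LYC {R} Y g.

(* Only meaningful for non-empty bounded sets, since [sup] and [inf] are
   real-valued. *)
Definition hausdorff_dist (R : realType) (T : Type) (d : T -> T -> R)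
    (A B : set T) : R :=
  Num.max (sup [set inf [set d x y | y in B] | x in A])
          (sup [set inf [set d y x | x in A] | y in B]).

Section hausdorff_dist_theory.
Context {R : realType} {T : Type} (d : T -> T -> R).
Hypothesis dxx : forall x, d x x = 0.
Hypothesis dC : forall x y, d x y = d y x.
Hypothesis d_triangle : forall y x z, d x z <= d x y + d y z.

Definition dbounded (A : set T) := exists p M, forall x, A x -> d p x <= M.

Let d_ge0 x y : 0 <= d x y.
Proof. have := d_triangle y x x; rewrite dxx (dC y x); lra. Qed.

Lemma hausdorff_distC A B : hausdorff_dist d A B = hausdorff_dist d B A.
Proof. by rewrite /hausdorff_dist maxC. Qed.

Let excess_le A B e : A !=set0 -> B !=set0 -> dbounded A -> dbounded B ->
  sup [set inf [set d x y | y in B] | x in A] <= e <->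
  forall r, e < r -> forall x, A x -> exists2 y, B y & d x y < r.
Proof.
move=> [a0 Aa0] [b0 Bb0] [p [M pM]] [q [N qN]].
have hi x : has_inf [set d x y | y in B].
  by split; [exists (d x b0), b0|exists 0 => _ [y _ <-]].
have hs : has_sup [set inf [set d x y | y in B] | x in A].
  split; first by exists (inf [set d a0 y | y in B]), a0.
  exists (M + d p q + N) => _ [x Ax <-].
  apply: (@le_trans _ _ (d x b0)); first by apply: ge_inf; [case: (hi x)|exists b0].
  have := d_triangle p x b0; have := d_triangle q p b0.
  have := pM _ Ax; have := qN _ Bb0; rewrite (dC x p); lra.
split=> [le_e r er x Ax|H].
  have : inf [set d x y | y in B] < r.
    apply: le_lt_trans er; apply: le_trans le_e.
    by apply: ub_le_sup; [case: hs|exists x].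
  by move=> /(inf_lt (proj1 (hi x)))[_ [y By <-] ?]; exists y.
apply: ge_sup; first by case: hs.
move=> _ [x Ax <-]; apply/ler_addgt0Pr => r r0.
have [|y By xy] := H (e + r) _ _ Ax; first by lra.
by apply/ltW/(le_lt_trans _ xy)/ge_inf; [case: (hi x)|exists y].
Qed.

Lemma hausdorff_dist_le A B e :
  A !=set0 -> B !=set0 -> dbounded A -> dbounded B ->
  hausdorff_dist d A B <= e <->
  forall r, e < r -> (forall x, A x -> exists2 y, B y & d x y < r) /\
                     (forall y, B y -> exists2 x, A x & d y x < r).
Proof.
move=> A0 B0 bA bB; rewrite /hausdorff_dist ge_max; split.
  by move=> /andP[/excess_le -/(_ A0 B0 bA bB) H1
                  /excess_le -/(_ B0 A0 bB bA) H2] r er; split; [exact: H1|exact: H2].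
by move=> H; apply/andP; split; apply/excess_le => // r /H[].
Qed.

Lemma hausdorff_distxx A : A !=set0 -> dbounded A -> hausdorff_dist d A A = 0.
Proof.
move=> A0 bA; apply/eqP; rewrite eq_le; apply/andP; split.
  by apply/hausdorff_dist_le => // r r0; split=> x Ax; exists x; rewrite ?dxx.
rewrite leNgt; apply/negP => h.
have [a Aa] := A0.
have /hausdorff_dist_le -/(_ A0 A0 bA bA) H := lexx (hausdorff_dist d A A).
have [/(_ _ Aa)[y _ +] _] := H _ h.
by rewrite ltNge d_ge0.
Qed.

Lemma hausdorff_dist_ge0 A B : A !=set0 -> B !=set0 ->
  dbounded A -> dbounded B -> 0 <= hausdorff_dist d A B.
Proof.
move=> A0 B0 bA bB; rewrite leNgt; apply/negP => h.
have [a Aa] := A0.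
have /hausdorff_dist_le -/(_ A0 B0 bA bB) H := lexx (hausdorff_dist d A B).
have [/(_ _ Aa)[y _ +] _] := H _ h.
by rewrite ltNge d_ge0.
Qed.

Lemma hausdorff_dist_triangle B A C : A !=set0 -> B !=set0 -> C !=set0 ->
  dbounded A -> dbounded B -> dbounded C ->
  hausdorff_dist d A C <= hausdorff_dist d A B + hausdorff_dist d B C.
Proof.
move=> A0 B0 C0 bA bB bC; apply/hausdorff_dist_le => // r hr.
have /hausdorff_dist_le -/(_ A0 B0 bA bB) HAB := lexx (hausdorff_dist d A B).
have /hausdorff_dist_le -/(_ B0 C0 bB bC) HBC := lexx (hausdorff_dist d B C).
set hAB := hausdorff_dist d A B in hr HAB.
set hBC := hausdorff_dist d B C in hr HBC.
pose k := (r - (hAB + hBC)) / 2.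
have [AB BA] : _ /\ _ := HAB (hAB + k) ltac:(rewrite /k; lra).
have [BC CB] : _ /\ _ := HBC (hBC + k) ltac:(rewrite /k; lra).
split=> [x /AB[y /BC[z Cz yz] xy]|z /CB[y /BA[x Ax yx] zy]].
- exists z => //; apply: le_lt_trans (d_triangle y x z) _.
  by rewrite /k in xy yz; lra.
- exists x => //; apply: le_lt_trans (d_triangle y z x) _.
  by rewrite /k in zy yx; lra.
Qed.

End hausdorff_dist_theory.

Section metric_compact.
Context {R : realType} {X : metricType R}.

Lemma mdist_triangle_mid (y x z : X) : mdist x z <= mdist x y + mdist y z.
Proof. exact: metric_triangle. Qed.

Lemma compact_seq_cluster (K : set X) (u : nat -> X) :
  compact K -> (forall n, K (u n)) ->
  exists2 x, K x & forall e N, 0 < e -> exists2 n, (N <= n)%N & mdist x (u n) < e.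
Proof.
move=> cK Ku; have uK : (u @ \oo) K by exists 0%N => // n _; exact: Ku.
have [x [Kx clx]] := cK _ _ uK.
exists x => // e N e0.
have uN : (u @ \oo) [set u n | n in [set n | (N <= n)%N]].
  by exists N => // n /= Nn; exists n.
have [_ [[n Nn <-]]] := clx _ _ uN (nbhsx_ballx x e e0).
by rewrite ballEmdist /= => xn; exists n.
Qed.

Lemma compact_dbounded (K : set X) :
  compact K -> K !=set0 -> dbounded (@mdist R X) K.
Proof.
move=> cK [p Kp]; exists p; apply: contrapT => /forallNP H.
have {}H n : exists x, K x /\ n%:R < mdist p x.
  have /existsNP[x /not_implyP[Kx /negP]] := H n%:R.
  by rewrite -ltNge => ?; exists x.
have [u uP] := choice H.
have [x Kx xu] := compact_seq_cluster cK (fun n => (uP n).1).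
have [n Nn xn] := xu 1 (Num.truncn (mdist p x + 1)).+1 ltr01.
have := (uP n).2; have := mdist_triangle_mid x p (u n).
have := truncnS_gt (mdist p x + 1).
have : ((Num.truncn (mdist p x + 1)).+1%:R <= n%:R :> R) by rewrite ler_nat.
lra.
Qed.

Lemma closed_mdist (A : set X) x : closed A ->
  (forall e, 0 < e -> exists2 y, A y & mdist x y < e) -> A x.
Proof.
move=> cA H; apply: cA => B /nbhs_ballP[e e0 eB].
have [y Ay xy] := H _ e0; exists y; split => //; apply: eB.
by rewrite ballEmdist.
Qed.

Lemma closure_mdist (A : set X) x : closure A x ->
  forall e, 0 < e -> exists2 y, A y & mdist x y < e.
Proof.
move=> clA e e0; have [y [Ay]] := clA _ (nbhsx_ballx x e e0).
by rewrite ballEmdist => xy; exists y.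
Qed.

Lemma compact_hausdorff_eq (A B : set X) :
  A !=set0 -> B !=set0 -> compact A -> compact B ->
  hausdorff_dist (@mdist R X) A B <= 0 -> A = B.
Proof.
move=> A0 B0 cA cB.
move=> /(hausdorff_dist_le (@mdistxx _ X) (@metric_sym _ X) mdist_triangle_mid
           _ A0 B0 (compact_dbounded cA A0) (compact_dbounded cB B0)) H.
have clA : closed A by apply: compact_closed cA; exact: metric_hausdorff.
have clB : closed B by apply: compact_closed cB; exact: metric_hausdorff.
apply/seteqP; split=> x xx; apply: closed_mdist => // e /H[H1 H2].
  exact: H1.
exact: H2.
Qed.

End metric_compact.

Record compact_set (R : realType) (X : metricType R) := CompactSet {
  cset :> set X;
  cset_compact : compact cset;
  cset_neq0 : cset !=set0 }.

Section hyperspace.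
Context {R : realType} (X : metricType R).

HB.instance Definition _ := gen_eqMixin (compact_set X).
HB.instance Definition _ := gen_choiceMixin (compact_set X).

Lemma compact_set_eq (A B : compact_set X) : cset A = cset B -> A = B.
Proof.
case: A B => [A cA A0] [B cB B0] /= AB; subst B.
by rewrite (Prop_irrelevance cA cB) (Prop_irrelevance A0 B0).
Qed.

Definition dH (A B : compact_set X) : R := hausdorff_dist (@mdist R X) A B.

Let cb (A : compact_set X) : dbounded (@mdist R X) A.
Proof. by apply: compact_dbounded; [exact: cset_compact|exact: cset_neq0]. Qed.

Let c0 := @cset_neq0 R X.

Let dHxx A : dH A A = 0.
Proof.
exact: (hausdorff_distxx (@mdistxx _ X) (@metric_sym _ X) mdist_triangle_mid).
Qed.

Let dH_positivity A B : dH A B = 0 -> A = B.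
Proof.
move=> AB; apply/compact_set_eq/compact_hausdorff_eq; do ?exact: c0.
- exact: cset_compact.
- exact: cset_compact.
- by rewrite -/(dH A B) AB.
Qed.

Let dHC A B : dH A B = dH B A.
Proof. exact: hausdorff_distC. Qed.

Let dH_triangle B A C : dH A C <= dH A B + dH B C.
Proof.
exact: (hausdorff_dist_triangle (@mdistxx _ X) (@metric_sym _ X)
  mdist_triangle_mid).
Qed.

HB.instance Definition _ := @isMetric.Build R (compact_set X)
  dH dHxx dH_positivity dHC dH_triangle.

End hyperspace.

Section hyperextension.
Context {R : realType} {X : metricType R} (f : X -> X).
Hypothesis cf : continuous f.

Let image_compact (A : compact_set X) : compact (f @` A).
Proof.
apply: continuous_compact; last exact: cset_compact.
exact: continuous_subspaceT.
Qed.

Let image_neq0 (A : compact_set X) : f @` A !=set0.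
Proof. by have [x Ax] := cset_neq0 A; exists (f x), x. Qed.

Definition hyperextension (A : compact_set X) : compact_set X :=
  CompactSet (@image_compact A) (image_neq0 A).

End hyperextension.

Definition upper_semicontinuous (R : realType) (X : topologicalType)
    (u : X -> R) : Prop :=
  forall x a, u x < a -> \forall y \near x, u y < a.

(* The level set of height 0 is the support, not {x | u x >= 0}. *)
Definition level (R : realType) (X : topologicalType) (u : X -> R) (a : R) :
    set X :=
  if a == 0 then closure [set x | 0 < u x] else [set x | a <= u x].

Record fuzzy_set (R : realType) (X : metricType R) := FuzzySet {
  membership :> X -> R;
  fuzzy_range : forall x, unit_interval R (membership x);
  fuzzy_usc : upper_semicontinuous membership;
  fuzzy_support : compact (level membership 0);
  fuzzy_height : level membership 1 !=set0 }.

Section level_theory.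
Context {R : realType} {X : metricType R}.
Implicit Types u v : X -> R.

Lemma level0 u : level u 0 = closure [set x | 0 < u x].
Proof. by rewrite /level eqxx. Qed.

Lemma level_gt0 u a : 0 < a -> level u a = [set x | a <= u x].
Proof. by move=> a0; rewrite /level gt_eqF. Qed.

Lemma level_le u a b : 0 <= a -> a <= b -> level u b `<=` level u a.
Proof.
rewrite le_eqVlt => /predU1P[<-|a0 ab].
  rewrite le_eqVlt => /predU1P[<-//|b0].
  rewrite level0 level_gt0// => x /= bx; apply: subset_closure => /=; lra.
by rewrite !level_gt0 ?(lt_le_trans a0)// => x /=; lra.
Qed.

Lemma usc_closed_level u a : upper_semicontinuous u -> closed [set x | a <= u x].
Proof.
move=> uu x clx; rewrite /= leNgt; apply/negP => /uu/clx[y [/= ay]].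
by rewrite ltNge ay.
Qed.

Lemma usc_of_levels u : (forall x, unit_interval R (u x)) ->
  (forall a, 0 < a -> closed [set x | a <= u x]) -> upper_semicontinuous u.
Proof.
move=> uI ucl x a xa.
have a0 : 0 < a by have := uI x; rewrite /unit_interval /= in_itv /=; lra.
have : open (~` [set x | a <= u x]) by apply: closed_openC; exact: ucl.
rewrite openE => /(_ x); rewrite /interior /= => H.
have {}H : nbhs x (~` [set x | a <= u x]) by apply: H; apply/negP; rewrite -ltNge.
by apply: filterS H => y /= /negP; rewrite -ltNge.
Qed.

Lemma usc_sup_attained u (K : set X) a : upper_semicontinuous u ->
  compact K -> (forall e, 0 < e -> exists2 x, K x & a - e < u x) ->
  exists2 x, K x & a <= u x.
Proof.
move=> uu cK H.
have {}H n : exists x, K x /\ a - n.+1%:R^-1 < u x.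
  by have [|x Kx ax] := H n.+1%:R^-1; [rewrite invr_gt0 ltr0n|exists x].
have [w wP] := choice H.
have [x Kx xw] := compact_seq_cluster cK (fun n => (wP n).1).
exists x => //; rewrite leNgt; apply/negP => xa.
pose b := (u x + a) / 2.
have : \forall y \near x, u y < b by apply: uu; rewrite /b; lra.
move=> /nbhs_ballP[e e0 eb].
have ba : 0 < a - b by rewrite /b; lra.
have [n Nn xn] := xw e (Num.truncn (a - b)^-1) e0.
have ub : u (w n) < b by apply: eb; rewrite ballEmdist.
have wn := (wP n).2.
have h : n.+1%:R^-1 < a - b.
  rewrite invf_plt ?posrE ?ltr0n//.
  by rewrite (lt_le_trans (truncnS_gt _))// ler_nat ltnS.
move: wn h; set k := _^-1 => wn h; lra.
Qed.

End level_theory.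

Section fuzzy_theory.
Context {R : realType} {X : metricType R}.
Implicit Types u v : fuzzy_set X.

Lemma fuzzy_set_eq u v : u =1 v -> u = v.
Proof.
case: u v => [u u1 u2 u3 u4] [v v1 v2 v3 v4] /= /funext uv; subst v.
by rewrite (Prop_irrelevance u1 v1) (Prop_irrelevance u2 v2)
  (Prop_irrelevance u3 v3) (Prop_irrelevance u4 v4).
Qed.

Lemma fuzzy_ge0 u x : 0 <= u x.
Proof. by have := fuzzy_range u x; rewrite /unit_interval/= in_itv/= => /andP[]. Qed.

Lemma fuzzy_le1 u x : u x <= 1.
Proof. by have := fuzzy_range u x; rewrite /unit_interval/= in_itv/= => /andP[]. Qed.

Lemma level_fuzzy_closed u a : 0 <= a -> closed (level u a).
Proof.
rewrite le_eqVlt => /predU1P[<-|a0]; first by rewrite level0; exact: closed_closure.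
by rewrite level_gt0//; apply: usc_closed_level; exact: fuzzy_usc.
Qed.

Lemma level_fuzzy_compact u a : 0 <= a -> compact (level u a).
Proof.
move=> a0; apply: (subclosed_compact _ (@fuzzy_support _ _ u)).
  exact: level_fuzzy_closed.
exact: level_le.
Qed.

Lemma level_fuzzy_neq0 u a : 0 <= a -> a <= 1 -> level u a !=set0.
Proof. by move=> a0 a1; have [x] := fuzzy_height u; exists x; exact: (level_le a0 a1). Qed.

Lemma fuzzy_support_dbounded u : dbounded (@mdist R X) (level u 0).
Proof. by apply: compact_dbounded; [exact: fuzzy_support|exact: level_fuzzy_neq0]. Qed.

Lemma level_fuzzy_dbounded u a : 0 <= a -> dbounded (@mdist R X) (level u a).
Proof.
move=> a0; have [p [M pM]] := fuzzy_support_dbounded u.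
by exists p, M => x /(level_le (lexx 0) a0); exact: pM.
Qed.

End fuzzy_theory.

Section fuzzy_distances.
Context {R : realType} {X : metricType R}.
Implicit Types u v : X -> R.

Definition level_dist u v (a : R) : R :=
  hausdorff_dist (@mdist R X) (level u a) (level v a).

Definition dist_sup u v : R :=
  sup [set level_dist u v a | a in unit_interval R].

Definition incr_homeomorphism (xi : R -> R) : Prop :=
  homeomorphism_between (unit_interval R) (unit_interval R) xi /\
  {in unit_interval R &, {homo xi : a b / a < b}}.

Definition dist_skorokhod u v : R :=
  inf [set e | 0 < e /\
    exists xi, [/\ incr_homeomorphism xi,
      sup [set `|xi a - a| | a in unit_interval R] <= e &
      dist_sup u (xi \o v) <= e]].

Definition dist_prod (p q : X * R) : R := Num.max (mdist p.1 q.1) `|p.2 - q.2|.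

Definition send u : set (X * R) :=
  [set p | [/\ level u 0 p.1, unit_interval R p.2 & p.2 <= u p.1]].

Definition dist_send u v : R := hausdorff_dist dist_prod (send u) (send v).

End fuzzy_distances.

Section zadeh.
Context {R : realType} {X : metricType R} (f : X -> X).

Definition zadeh_fun (u : X -> R) (x : X) : R :=
  if `[< f @^-1` [set x] !=set0 >] then sup [set u y | y in f @^-1` [set x]]
  else 0.

Hypothesis cf : continuous f.
Implicit Types u : fuzzy_set X.

Let has_sup_fibre u x : f @^-1` [set x] !=set0 ->
  has_sup [set u y | y in f @^-1` [set x]].
Proof.
move=> [y fy]; split; first by exists (u y), y.
by exists 1 => _ [z _ <-]; exact: fuzzy_le1.
Qed.

Let zadeh_ge u y : u y <= zadeh_fun u (f y).
Proof.
have y0 : f @^-1` [set f y] !=set0 by exists y.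
rewrite /zadeh_fun asboolT//; apply: ub_le_sup; last by exists y.
by have [] := has_sup_fibre u y0.
Qed.

Let zadeh_ge0 u x : 0 <= zadeh_fun u x.
Proof.
rewrite /zadeh_fun; case: asboolP => // -[y fy].
by rewrite (le_trans (fuzzy_ge0 u y))//; have := zadeh_ge u y;
  rewrite fy /zadeh_fun asboolT//; exists y.
Qed.

Let zadeh_range u x : unit_interval R (zadeh_fun u x).
Proof.
rewrite /unit_interval /= in_itv /= zadeh_ge0 /= /zadeh_fun.
case: asboolP => // x0; apply: ge_sup; first by have [] := has_sup_fibre u x0.
by move=> _ [y _ <-]; exact: fuzzy_le1.
Qed.

Let zadeh_attained u x a : 0 < a -> a <= zadeh_fun u x ->
  exists2 y, f y = x & a <= u y.
Proof.
move=> a0; rewrite /zadeh_fun; case: asboolP => [x0 ax|]; last by lra.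
have cK : compact (level u 0 `&` f @^-1` [set x]).
  apply: (subclosed_compact _ (@fuzzy_support _ _ u)); last exact: subIsetl.
  apply: closedI; first exact: level_fuzzy_closed.
  apply: preimage_closed; first by move=> ? ?; exact: cf.
  by apply: accessible_closed_set1; apply: hausdorff_accessible; exact: metric_hausdorff.
have [|y [_ fy] ay] := usc_sup_attained (a := a) (@fuzzy_usc _ _ u) cK.
  move=> e e0; pose e' := Num.min e a.
  have e'0 : 0 < e' by rewrite /e' lt_min e0 a0.
  have [_ [y fy <-] ey] := sup_adherent e'0 (has_sup_fibre u x0).
  have e'e : e' <= e by rewrite /e' ge_min lexx.
  have e'a : e' <= a by rewrite /e' ge_min lexx orbT.
  exists y; last by lra.
  split => //; rewrite level0; apply: subset_closure => /=; lra.
by exists y.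
Qed.

Lemma zadeh_level u a : 0 < a -> level (zadeh_fun u) a = f @` level u a.
Proof.
move=> a0; rewrite !level_gt0//; apply/seteqP; split=> [x /=|_ [y /= ay <-]].
  by move=> /(zadeh_attained a0)[y fy ay]; exists y.
exact: le_trans (zadeh_ge u y).
Qed.

Let level_image_closed u a : 0 <= a -> closed (f @` level u a).
Proof.
move=> a0; apply: compact_closed; first exact: metric_hausdorff.
apply: continuous_compact; last exact: level_fuzzy_compact.
exact: continuous_subspaceT.
Qed.

Let zadeh_usc u : upper_semicontinuous (zadeh_fun u).
Proof.
apply: usc_of_levels => [|a a0]; first exact: zadeh_range.
by rewrite -level_gt0// zadeh_level//; apply: level_image_closed; exact: ltW.
Qed.

Let zadeh_support u : compact (level (zadeh_fun u) 0).
Proof.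
apply: (@subclosed_compact _ _ (f @` level u 0)).
- by rewrite level0; exact: closed_closure.
- apply: continuous_compact; last exact: level_fuzzy_compact.
  exact: continuous_subspaceT.
- have -> : f @` level u 0 = closure (f @` level u 0).
    by apply/closure_id; exact: level_image_closed.
  rewrite level0; apply: closureS => x /= x0; have [y fy xy] := zadeh_attained x0 (lexx _).
  exists y => //; rewrite level0; apply: subset_closure.
  exact: (lt_le_trans x0 xy).
Qed.

Let zadeh_height u : level (zadeh_fun u) 1 !=set0.
Proof.
rewrite zadeh_level//; have [x ux] := fuzzy_height u; by exists (f x), x.
Qed.

Definition zadeh u : fuzzy_set X :=
  FuzzySet (@zadeh_range u) (@zadeh_usc u) (@zadeh_support u) (@zadeh_height u).

End zadeh.

Section fuzzy_metrics.
Context {R : realType} {X : metricType R}.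
Implicit Types u v w : fuzzy_set X.

Local Notation mdxx := (@mdistxx R X).
Local Notation mdC := (@metric_sym R X).
Local Notation mdT := (@mdist_triangle_mid R X).
Local Notation I := (unit_interval R).

Let IP a : I a <-> 0 <= a /\ a <= 1.
Proof. by rewrite /unit_interval /= in_itv /=; split=> /andP. Qed.

Let I0 : I 0. Proof. by apply/IP. Qed.

Let mI a : I a -> a \in I. Proof. by move=> ?; rewrite inE. Qed.

Let h u a v b := hausdorff_dist (@mdist R X) (level u a) (level v b).

Let hC u a v b : h u a v b = h v b u a.
Proof. exact: hausdorff_distC. Qed.

Let hxx u a : I a -> h u a u a = 0.
Proof.
move=> /IP[a0 a1]; apply: (hausdorff_distxx mdxx mdC mdT).
  exact: level_fuzzy_neq0.
exact: level_fuzzy_dbounded.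
Qed.

Let hT v b u a w c : I a -> I b -> I c -> h u a w c <= h u a v b + h v b w c.
Proof.
move=> /IP[a0 a1] /IP[b0 b1] /IP[c0 c1].
apply: (hausdorff_dist_triangle mdxx mdC mdT);
  solve [exact: level_fuzzy_neq0|exact: level_fuzzy_dbounded].
Qed.

Let hP u a v b e : I a -> I b -> h u a v b <= e <->
  forall r, e < r ->
    (forall x, level u a x -> exists2 y, level v b y & mdist x y < r) /\
    (forall y, level v b y -> exists2 x, level u a x & mdist y x < r).
Proof.
move=> /IP[a0 a1] /IP[b0 b1]; apply: (hausdorff_dist_le mdxx mdC mdT);
  solve [exact: level_fuzzy_neq0|exact: level_fuzzy_dbounded].
Qed.

Let h_ge0 u a v b : I a -> I b -> 0 <= h u a v b.
Proof.
move=> Ia Ib; have := hT v u u Ia Ib Ia; rewrite (hxx _ Ia) [h v _ _ _]hC.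
by rewrite -mulr2n pmulrn_lge0.
Qed.

Let h_bounded u v : exists M, forall a b, I a -> I b -> h u a v b <= M.
Proof.
have [p [M pM]] := fuzzy_support_dbounded u.
have [q [N qN]] := fuzzy_support_dbounded v.
exists (M + mdist p q + N) => a b Ia Ib; apply/hP => // r hr.
have Mx x y : level u a x -> level v b y -> mdist x y < r.
  move: Ia Ib => /IP[a0 a1] /IP[b0 b1].
  move=> /(level_le (lexx 0) a0)/pM xM /(level_le (lexx 0) b0)/qN yN.
  have := mdT p x y; have := mdT q p y; rewrite (mdC x p); lra.
move: Ia Ib => /IP[a0 a1] /IP[b0 b1]; split=> x lx.
  by have [y ly] := level_fuzzy_neq0 v b0 b1; exists y => //; exact: Mx.
by have [y ly] := level_fuzzy_neq0 u a0 a1; exists y => //; rewrite mdC; exact: Mx.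
Qed.

Lemma dist_sup_le u v e :
  dist_sup u v <= e <-> forall a, I a -> level_dist u v a <= e.
Proof.
have hs : has_sup [set level_dist u v a | a in I].
  split; first by exists (level_dist u v 0), 0.
  by have [M hM] := h_bounded u v; exists M => _ [a Ia <-]; exact: hM.
split=> [H a Ia|H].
  by apply: le_trans H; apply: ub_le_sup; [case: hs|exists a].
by apply: ge_sup; [case: hs|move=> _ [a Ia <-]; exact: H].
Qed.

Lemma eq_levels u v : (forall a, I a -> level u a = level v a) -> u = v.
Proof.
move=> H.
suff K w1 w2 : (forall a, I a -> level w1 a = level w2 a) ->
    forall x, w1 x <= w2 x.
  by apply: fuzzy_set_eq => x; apply/eqP; rewrite eq_le !K// => a /H.
move=> {}H x; have := fuzzy_ge0 w1 x; rewrite le_eqVlt => /predU1P[<-|x0].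
  exact: fuzzy_ge0.
have : level w2 (w1 x) x by rewrite -H ?level_gt0//=; exact: fuzzy_range.
by rewrite level_gt0.
Qed.

Let dsxx u : dist_sup u u = 0.
Proof.
apply/eqP; rewrite eq_le; apply/andP; split.
  by apply/dist_sup_le => a Ia; rewrite /level_dist -/(h _ _ _ _) hxx.
have /dist_sup_le/(_ 0 I0) := lexx (dist_sup u u).
by rewrite /level_dist -/(h _ _ _ _) hxx.
Qed.

Let ds_pos u v : dist_sup u v = 0 -> u = v.
Proof.
move=> uv; apply: eq_levels => a Ia.
move: (Ia) => /IP[a0 a1].
apply: compact_hausdorff_eq; do ?[exact: level_fuzzy_neq0|exact: level_fuzzy_compact].
by have /dist_sup_le := lexx (dist_sup u v); rewrite uv; exact.
Qed.

Let dsC u v : dist_sup u v = dist_sup v u.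
Proof.
congr (sup _); apply: eq_imagel => a _; exact: hausdorff_distC.
Qed.

Let dsT v u w : dist_sup u w <= dist_sup u v + dist_sup v w.
Proof.
apply/dist_sup_le => a Ia; apply: le_trans (hT v _ _ Ia Ia Ia) _.
have /dist_sup_le/(_ a Ia) := lexx (dist_sup u v).
have /dist_sup_le/(_ a Ia) := lexx (dist_sup v w).
rewrite /level_dist -!/(h _ _ _ _); lra.
Qed.

Lemma incr_homeomorphism_id : incr_homeomorphism (@id R).
Proof.
split=> [|//]; exists id; split => //; exact: continuous_subspaceT (fun x => @cvg_id _ _).
Qed.

Let within_comp (S T U : topologicalType) (A : set S) (B : set T)
    (g1 : S -> T) (g2 : T -> U) : set_fun A B g1 ->
  {within A, continuous g1} -> {within B, continuous g2} ->
  {within A, continuous (g2 \o g1)}.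
Proof.
move=> AB /subspace_continuousP c1 /subspace_continuousP c2.
apply/subspace_continuousP => x Ax W gW.
have c2W := c2 _ (AB _ Ax) W gW.
have := c1 _ Ax _ c2W; rewrite /nbhs/= /within/=.
by apply: filterS => y /= + Ay => /(_ Ay); apply; exact: AB.
Qed.

Section incr_homeomorphism_theory.
Variable xi : R -> R.
Hypothesis xiP : incr_homeomorphism xi.

Lemma incr_homeomorphism_unit a : I a -> I (xi a).
Proof. by have [[z [+ _ _ _ _]] _] := xiP; exact. Qed.

Lemma incr_homeomorphism_lt a b : I a -> I b -> (xi a < xi b) = (a < b).
Proof.
move=> Ia Ib; have [_ H] := xiP; apply/idP/idP => [|ab]; last by apply: H => //; exact: mI.
apply: contraTT; rewrite -!leNgt le_eqVlt => /predU1P[->//|ba].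
by apply/ltW/H => //; exact: mI.
Qed.

Lemma incr_homeomorphism_le a b : I a -> I b -> (xi a <= xi b) = (a <= b).
Proof. by move=> Ia Ib; rewrite !leNgt incr_homeomorphism_lt. Qed.

Lemma incr_homeomorphism_surj b : I b -> exists2 a, I a & xi a = b.
Proof.
move=> Ib; have [[z [_ zI [_ zK] _ _]] _] := xiP.
by exists (z b); [exact: zI|apply: zK; exact: mI].
Qed.

Lemma incr_homeomorphism0 : xi 0 = 0.
Proof.
have [a Ia xa] := incr_homeomorphism_surj I0.
have := incr_homeomorphism_le I0 Ia; rewrite xa.
move: (Ia) => /IP[-> _] x0; apply/eqP; rewrite eq_le x0.
by have /IP[] := incr_homeomorphism_unit I0.
Qed.

Lemma incr_homeomorphism1 : xi 1 = 1.
Proof.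
have I1 : I 1 by apply/IP.
have [a Ia xa] := incr_homeomorphism_surj I1.
have := incr_homeomorphism_le Ia I1; rewrite xa.
move: (Ia) => /IP[_ ->] x1; apply/eqP; rewrite eq_le x1 andbT.
by have /IP[] := incr_homeomorphism_unit I1.
Qed.

Lemma incr_homeomorphism_level v a : I a -> level (xi \o v) (xi a) = level v a.
Proof.
move=> Ia; move: (Ia) => /IP[+ _]; rewrite le_eqVlt => /predU1P[<-|a0].
  rewrite incr_homeomorphism0 !level0; congr closure.
  have xv x : (0 < xi (v x)) = (0 < v x).
    have := incr_homeomorphism_lt I0 (fuzzy_range v x).
    by rewrite incr_homeomorphism0.
  by apply/seteqP; split=> x /=; rewrite xv.
have xa0 : 0 < xi a by rewrite -incr_homeomorphism0 incr_homeomorphism_lt.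
rewrite !level_gt0//; apply/seteqP.
by split=> x /=; rewrite incr_homeomorphism_le//; exact: fuzzy_range.
Qed.

Lemma incr_homeomorphism_inv : exists zeta, incr_homeomorphism zeta /\
  forall a, I a -> xi (zeta a) = a.
Proof.
have [[z [xI zI [xK zK] cx cz]] _] := xiP.
exists z; split; last by move=> a /mI; exact: zK.
split; first by exists xi.
move=> a b /set_mem Ia /set_mem Ib ab.
by rewrite -incr_homeomorphism_lt ?zK ?inE//; exact: zI.
Qed.

Lemma comp_fuzzy v : exists w : fuzzy_set X, membership w = xi \o v.
Proof.
have wI x : I ((xi \o v) x) by apply: incr_homeomorphism_unit; exact: fuzzy_range.
have wu : upper_semicontinuous (xi \o v).
  apply: usc_of_levels => // a a0; have [a1|a1] := lerP a 1; last first.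
    have -> : [set x | a <= (xi \o v) x] = set0; last exact: closed0.
    by rewrite -subset0 => x /=; have /IP[_ /=] := wI x; lra.
  have [|b Ib ba] := @incr_homeomorphism_surj a; first by apply/IP; lra.
  rewrite -(level_gt0 _ a0) -ba incr_homeomorphism_level//.
  by apply: level_fuzzy_closed; move/IP: Ib => [].
have w0 : compact (level (xi \o v) 0).
  by rewrite -incr_homeomorphism0 incr_homeomorphism_level//; exact: fuzzy_support.
have w1 : level (xi \o v) 1 !=set0.
  rewrite -incr_homeomorphism1 incr_homeomorphism_level//; last by apply/IP.
  exact: fuzzy_height.
by exists (FuzzySet wI wu w0 w1).
Qed.

Lemma dist_sup_reindex u v e : dist_sup u (xi \o v) <= e <->
  forall a, I a -> h u (xi a) v a <= e.
Proof.
have [w wE] := comp_fuzzy v; rewrite -wE; split.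
  move=> /dist_sup_le H a Ia.
  have := H _ (incr_homeomorphism_unit Ia).
  by rewrite /level_dist wE incr_homeomorphism_level.
move=> H; apply/dist_sup_le => a /incr_homeomorphism_surj[b Ib <-].
by rewrite /level_dist wE incr_homeomorphism_level//; exact: H.
Qed.

Lemma dist_id_le e : sup [set `|xi a - a| | a in I] <= e <->
  forall a, I a -> `|xi a - a| <= e.
Proof.
have hs : has_sup [set `|xi a - a| | a in I].
  split; first by exists `|xi 0 - 0|, 0.
  exists 1 => _ [a Ia <-]; move: (Ia) => /IP[a0 a1].
  have /IP[xa0 xa1] := incr_homeomorphism_unit Ia.
  by rewrite ler_norml; apply/andP; split; lra.
split=> [H a Ia|H].
  by apply: le_trans H; apply: ub_le_sup; [case: hs|exists a].
by apply: ge_sup; [case: hs|move=> _ [a Ia <-]; exact: H].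
Qed.

End incr_homeomorphism_theory.

Let sk u v e := exists2 xi, incr_homeomorphism xi &
  forall a, I a -> `|xi a - a| <= e /\ h u (xi a) v a <= e.

Let skP u v e : sk u v e <-> exists xi, [/\ incr_homeomorphism xi,
  sup [set `|xi a - a| | a in I] <= e & dist_sup u (xi \o v) <= e].
Proof.
split=> [[xi xiP H]|[xi [xiP H1 H2]]].
  exists xi; split => //; first by apply/dist_id_le => // a /H[].
  by apply/dist_sup_reindex => // a /H[].
exists xi => // a Ia; split; first exact: (dist_id_le xiP e).1.
exact: (dist_sup_reindex xiP u v e).1.
Qed.

Let has_inf_sk u v : has_inf [set e | 0 < e /\
    exists xi, [/\ incr_homeomorphism xi,
      sup [set `|xi a - a| | a in I] <= e & dist_sup u (xi \o v) <= e]].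
Proof.
split; last by exists 0 => e [/ltW].
have [M hM] := h_bounded u v.
exists (Num.max M 1); split; first by rewrite lt_max ltr01 orbT.
apply/skP; exists id; first exact: incr_homeomorphism_id.
by move=> a Ia; rewrite subrr normr0 !le_max ler01 orbT hM.
Qed.

Let dk_ge0 u v : 0 <= dist_skorokhod u v.
Proof. by apply: lb_le_inf; [case: (has_inf_sk u v)|move=> e [/ltW]]. Qed.

Let dk_le u v e : 0 < e -> sk u v e -> dist_skorokhod u v <= e.
Proof.
by move=> e0 /skP uv; apply: ge_inf; [case: (has_inf_sk u v)|split].
Qed.

Let dk_lt u v r : dist_skorokhod u v < r -> sk u v r.
Proof.
move=> /(inf_lt (proj1 (has_inf_sk u v)))[e [e0 /skP[xi xiP H]] er].
by exists xi => // a /H[H1 H2]; split; apply/ltW; exact: le_lt_trans er.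
Qed.

Let skC u v e : sk u v e -> sk v u e.
Proof.
move=> [xi xiP H]; have [z [zP xzK]] := incr_homeomorphism_inv xiP.
exists z => // a Ia.
have [] := H _ (incr_homeomorphism_unit zP Ia); rewrite (xzK _ Ia).
by rewrite distrC hC.
Qed.

Let dkxx u : dist_skorokhod u u = 0.
Proof.
apply/eqP; rewrite eq_le dk_ge0 andbT; apply/ler_addgt0Pr => e e0.
rewrite add0r; apply: dk_le => //; exists id; first exact: incr_homeomorphism_id.
by move=> a Ia; rewrite subrr normr0 hxx// ltW.
Qed.

Let dkC_le u v : dist_skorokhod u v <= dist_skorokhod v u.
Proof.
apply/ler_addgt0Pr => e e0; apply: dk_le; first by have := dk_ge0 v u; lra.
by apply/skC/dk_lt; lra.
Qed.

Let dkC u v : dist_skorokhod u v = dist_skorokhod v u.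
Proof. by apply: le_anti; apply/andP; split; apply: dkC_le. Qed.

Let dk_pos u v : dist_skorokhod u v = 0 -> u = v.
Proof.
suff K w1 w2 : dist_skorokhod w1 w2 = 0 -> forall x, w2 x <= w1 x.
  move=> uv; have vu : dist_skorokhod v u = 0 by rewrite dkC.
  by apply: fuzzy_set_eq => x; apply: le_anti; rewrite (K _ _ uv) (K _ _ vu).
move=> w12 x; rewrite leNgt; apply/negP => xlt.
set b := w2 x; pose c := (w1 x + b) / 2.
have [wc cb] : w1 x < c /\ c < b by rewrite /c /b; split; lra.
have /nbhs_ballP[e /= e0 eb] := fuzzy_usc wc.
pose d := Num.min (e / 2) (b - c).
have d0 : 0 < d by rewrite /d lt_min; apply/andP; split; lra.
have de : d < e by rewrite /d gt_min; apply/orP; left; lra.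
have dbc : d <= b - c by rewrite /d ge_min lexx orbT.
have [xi xiP H] : sk w1 w2 d by apply: dk_lt; rewrite w12.
have Ib : I b by exact: fuzzy_range.
have [xb hb] := H _ Ib.
have b0 : 0 < b by have := fuzzy_ge0 w1 x; rewrite /b; lra.
have xb0 : 0 < xi b.
  by rewrite -(incr_homeomorphism0 xiP) (incr_homeomorphism_lt xiP).
move/(hP _ _ _ (incr_homeomorphism_unit xiP Ib) Ib) : hb => /(_ _ de)[_].
rewrite !level_gt0// => /(_ x (lexx _))[y /= by1 xy].
have : w1 y < c by apply: eb; rewrite ballEmdist.
by move: xb; rewrite ler_norml => /andP[]; lra.
Qed.

Let dkT v u w :
  dist_skorokhod u w <= dist_skorokhod u v + dist_skorokhod v w.
Proof.
apply/ler_addgt0Pr => e e0.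
have e20 : 0 < e / 2 by lra.
have ltDh (a : R) : a < a + e / 2 by lra.
have [x xP xH] := dk_lt (ltDh (dist_skorokhod u v)).
have [z zP zH] := dk_lt (ltDh (dist_skorokhod v w)).
move: (dist_skorokhod u v) (dist_skorokhod v w) (dk_ge0 u v) (dk_ge0 v w) xH zH.
move=> duv dvw duv0 dvw0 xH zH.
apply: dk_le; first by lra.
exists (x \o z).
  have [[x' [xI x'I [xK x'K] cx cx']] xlt] := xP.
  have [[z' [zI z'I [zK z'K] cz cz']] zlt] := zP.
  split; first exists (z' \o x'); first split.
  - by move=> a /zI/xI.
  - by move=> a /x'I/z'I.
  - split=> a /set_mem Ia /=.
      by rewrite xK ?zK//; apply: mI => //; exact: zI.
    by rewrite z'K ?x'K//; apply: mI => //; exact: x'I.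
  - exact: (within_comp zI cz cx).
  - exact: (within_comp x'I cx' cz').
  - move=> a b Ia Ib ab; apply: xlt; last exact: zlt.
      by apply/mI/zI/set_mem.
    by apply/mI/zI/set_mem.
move=> a Ia; have Iz := incr_homeomorphism_unit zP Ia.
have [z1 z2] := zH _ Ia; have [x1 x2] := xH _ Iz; split => /=.
  by apply: le_trans (ler_distD (z a) _ _) _; lra.
apply: le_trans (hT v u w (incr_homeomorphism_unit xP Iz) Iz Ia) _.
by apply: le_trans (lerD x2 z2) _; lra.
Qed.

Let dpxx (p : X * R) : dist_prod p p = 0.
Proof. by rewrite /dist_prod mdxx subrr normr0 maxxx. Qed.

Let dpC (p q : X * R) : dist_prod p q = dist_prod q p.
Proof. by rewrite /dist_prod mdC distrC. Qed.

Let dpT (q p r : X * R) : dist_prod p r <= dist_prod p q + dist_prod q r.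
Proof.
rewrite /dist_prod ge_max; apply/andP; split.
  by apply: le_trans (mdT q.1 p.1 r.1) _; apply: lerD; rewrite le_max lexx.
apply: le_trans (ler_distD q.2 _ _) _.
by apply: lerD; rewrite le_max lexx orbT.
Qed.

Let send_neq0 u : send u !=set0.
Proof.
have [x ux] := @level_fuzzy_neq0 _ _ u 0 (lexx _) ler01.
by exists (x, 0); split => //=; exact: fuzzy_ge0.
Qed.

Let send_dbounded u : dbounded dist_prod (send u).
Proof.
have [p [M pM]] := fuzzy_support_dbounded u.
exists (p, 0), (Num.max M 1) => -[x a] [/= ux /IP[a0 a1] _].
rewrite /dist_prod ge_max /= !le_max pM// sub0r normrN ger0_norm// a1 orbT.
by [].
Qed.

Let dSxx u : dist_send u u = 0.
Proof. exact: (hausdorff_distxx dpxx dpC dpT). Qed.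

Let dSC u v : dist_send u v = dist_send v u.
Proof. exact: hausdorff_distC. Qed.

Let dST v u w : dist_send u w <= dist_send u v + dist_send v w.
Proof. exact: (hausdorff_dist_triangle dpxx dpC dpT). Qed.

Let dS_pos u v : dist_send u v = 0 -> u = v.
Proof.
suff K w1 w2 : dist_send w1 w2 = 0 -> forall x, w1 x <= w2 x.
  by move=> uv; apply: fuzzy_set_eq => x; apply/eqP; rewrite eq_le !K// dSC.
move=> w12 x; rewrite leNgt; apply/negP => xlt.
set b := w1 x; pose c := (w2 x + b) / 2.
have [wc cb] : w2 x < c /\ c < b by rewrite /c /b; split; lra.
have /nbhs_ballP[e /= e0 eb] := fuzzy_usc wc.
pose d := Num.min e (b - c).
have d0 : 0 < d by rewrite /d lt_min; apply/andP; split; lra.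
have de : d <= e by rewrite /d ge_min lexx.
have dbc : d <= b - c by rewrite /d ge_min lexx orbT.
have b0 : 0 < b by have := fuzzy_ge0 w2 x; rewrite /b; lra.
have : dist_send w1 w2 <= 0 by rewrite w12.
move/(hausdorff_dist_le dpxx dpC dpT _ (send_neq0 w1) (send_neq0 w2)
  (send_dbounded w1) (send_dbounded w2)) => /(_ _ d0)[+ _].
have xb : send w1 (x, b).
  split => //=; last exact: fuzzy_range.
  by rewrite level0; exact: subset_closure.
move=> /(_ _ xb)[[y a] [/= _ _ ay]].
rewrite /dist_prod gt_max /= => /andP[xy ba].
have : w2 y < c by apply: eb; rewrite ballEmdist /=; lra.
by move: ba; rewrite ltr_norml => /andP[]; lra.
Qed.

Definition fuzzy_infty : Type := fuzzy_set X.
HB.instance Definition _ := gen_eqMixin fuzzy_infty.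
HB.instance Definition _ := gen_choiceMixin fuzzy_infty.
HB.instance Definition _ := @isMetric.Build R fuzzy_infty
  dist_sup dsxx ds_pos dsC dsT.

Definition fuzzy_skorokhod : Type := fuzzy_set X.
HB.instance Definition _ := gen_eqMixin fuzzy_skorokhod.
HB.instance Definition _ := gen_choiceMixin fuzzy_skorokhod.
HB.instance Definition _ := @isMetric.Build R fuzzy_skorokhod
  dist_skorokhod dkxx dk_pos dkC dkT.

Definition fuzzy_send : Type := fuzzy_set X.
HB.instance Definition _ := gen_eqMixin fuzzy_send.
HB.instance Definition _ := gen_choiceMixin fuzzy_send.
HB.instance Definition _ := @isMetric.Build R fuzzy_send
  dist_send dSxx dS_pos dSC dST.

End fuzzy_metrics.

Arguments fuzzy_infty {R} X.
Arguments fuzzy_skorokhod {R} X.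
Arguments fuzzy_send {R} X.

(* Main.v *)
Require Import Defs.
From mathcomp Require Import all_boot all_order all_algebra.
From mathcomp Require Import all_classical all_reals all_analysis.
From mathcomp Require Import lra.

Import Order.TTheory GRing.Theory Num.Theory.
Import numFieldNormedType.Exports.

Local Open Scope classical_set_scope.
Local Open Scope ring_scope.

Set Implicit Arguments.
Unset Strict Implicit.
Unset Printing Implicit Defensive.

(** Sensitivity and proximality of the fuzzy system are inherited by the
hyperspace because the level cuts of a fuzzy set evolve under the set-valued
map, and a Mycielski construction then turns these two local properties of
the hyperspace back into Cantor sets.

Let [C] be a ball of fuzzy sets around the characteristic function of a compact
set [A].  For [dist_sup] and [dist_skorokhod] all cuts of the members of [C]
are close to [A]; for [dist_send] this holds for the cuts of height at most
[1 - eta], with [eta] as small as wanted ([dist_send_crisp]).  In the three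
cases, the distance of two fuzzy sets is bounded below by the distance of their
supports, and if two fuzzy sets are further apart than [e], then some pair of
cuts, at a height among those just described, is at least [e] apart
([dist_sup_attained], [dist_send_attained]).  Since the Zadeh extension acts on
cuts by the hyperextension ([alpha_cut_zadeh]), a Li-Yorke pair of fuzzy sets
chosen near the characteristic functions of [A] and [B] yields compact sets near
[A] and [B] whose orbits are arbitrarily close at some late time (the supports)
and others whose orbits are at a fixed distance at some late time (a suitable
cut, depending on the time).  This is [CD_LYC_hyperspace_of_fuzzy].

So for every [n], the pairs of compact sets that are closer than [1 / n.+1] at
some time from [n] on, and further apart than [e / 3] at another such time,
contain a dense open subset of the square of the hyperspace.  The hyperspace of
a complete space is complete ([metric_complete_hyperspace]), and in a complete
space one can build, inside countably many prescribed open sets, Cantor sets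
any two points of which satisfy all but finitely many of a sequence of dense
open relations ([mycielski]): at each stage, only finitely many cells have to be
separated from each other.  The Cantor sets that this gives in the hyperspace
consist of Li-Yorke pairs ([frequently_near_far_CD_LYC]).
*)

Lemma invSn_lt {R : realType} (e : R) n :
  0 < e -> (Num.truncn e^-1 <= n)%N -> n.+1%:R^-1 < e.
Proof.
move=> e0 en; rewrite invf_plt ?posrE//.
by apply: lt_le_trans (truncnS_gt _) _; rewrite ler_nat ltnS.
Qed.

Section metric_basics.
Context {R : realType} {X : metricType R}.

Lemma mdistC (x y : X) : mdist x y = mdist y x.
Proof. exact: metric_sym. Qed.

Lemma mdist_distl (a b a' b' : X) :
  `|mdist a b - mdist a' b'| <= mdist a a' + mdist b b'.
Proof.
have h1 := mdist_triangle_mid a' a b; have h2 := mdist_triangle_mid b' a' b.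
have h3 := mdist_triangle_mid a a' b'; have h4 := mdist_triangle_mid b a b'.
rewrite (mdistC a' a) in h3; rewrite (mdistC b' b) in h2.
by rewrite ler_norml; apply/andP; split; lra.
Qed.

End metric_basics.

(** * Upper and lower limits as frequently occurring values *)

Section frequently.
Context {R : realType}.
Implicit Types (u : nat -> R) (a e : R).

Lemma le_limn_esupP u e :
  (e%:E <= limn_esup (fun n => (u n)%:E))%E <->
  forall a N, a < e -> exists2 n, (N <= n)%N & a < u n.
Proof.
split=> [H a N ae|H].
- have : (a%:E < ereal_sup [set (u n)%:E | n in [set n | (N <= n)%N]])%E.
    apply: (@lt_le_trans _ _ e%:E); first by rewrite lte_fin.
    apply: le_trans H _; apply: ereal_inf_lbound.
    by exists [set n | (N <= n)%N] => //; exists N.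
  move=> /ereal_sup_gt[_ [n /= Nn <-]]; rewrite lte_fin => an.
  by exists n.
- apply: le_ereal_inf_tmp => _ [V [N _ NV] <-].
  apply/lee_subgt0Pr => d d0.
  have [n Nn an] := H (e - d) N ltac:(lra).
  apply: (@le_trans _ _ (u n)%:E); first by rewrite -EFinB lee_fin ltW.
  by apply: ereal_sup_ubound; exists n => //; exact: NV.
Qed.

Lemma limn_einf_eq0P u : (forall n, 0 <= u n) ->
  limn_einf (fun n => (u n)%:E) = 0%E <->
  forall e N, 0 < e -> exists2 n, (N <= n)%N & u n < e.
Proof.
move=> u0.
have NE : (\- (fun n => (u n)%:E) = (fun n => (- u n)%:E))%E by [].
have le0 : (limn_esup (fun n => (- u n)%:E) <= 0%:E)%E.
  apply: (@le_trans _ _ (ereal_sup [set (- u n)%:E | n in setT])).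
    by apply: ereal_inf_lbound; exists setT => //; exact: filterT.
  by apply: ge_ereal_sup => _ [n _ <-]; rewrite lee_fin oppr_le0.
have -> : limn_einf (fun n => (u n)%:E) = 0%E <->
    (0%:E <= limn_esup (fun n => (- u n)%:E))%E.
  rewrite /limn_einf NE; split=> [/eqP|h]; first by rewrite oppe_eq0 => /eqP ->.
  by apply/eqP; rewrite oppe_eq0 eq_le h le0.
rewrite le_limn_esupP; split=> H e N e0.
  have [n Nn un] := H (- e) N ltac:(lra).
  by exists n => //; lra.
have [n Nn un] := H (- e) N ltac:(lra).
by exists n => //; lra.
Qed.

End frequently.

(** * The ternary set and its digits *)

Section ternary_digits.
Context {R : realType}.
Implicit Types x y : R.

Lemma unit_intervalP x : unit_interval R x <-> 0 <= x <= 1.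
Proof. by rewrite /unit_interval /= in_itv. Qed.

Lemma ternary_set_unit x : ternary_set R x -> 0 <= x <= 1.
Proof. by move=> /(_ 0%N I) /unit_intervalP. Qed.

(** On the ternary set this is the expanding map whose inverse branches are the
two contractions that define [cantor_stage]; its itinerary with respect to the
two halves, [ternary_digit], is the ternary expansion with digits 0 and 2 read
as booleans. *)
Definition tripling x : R := if x <= 1/2 then 3 * x else 3 * x - 2.

Definition ternary_digit x (n : nat) : bool := 1/2 < iter n tripling x.

Lemma cantor_stageS_tripling n x : cantor_stage R n.+1 x ->
  [/\ cantor_stage R n (tripling x), 0 <= tripling x <= 1 &
      (x <= 1/3) || (2/3 <= x)].
Proof.
have stage01 m c : cantor_stage R m c -> 0 <= c <= 1.
  elim: m c => [c /unit_intervalP//|m IH c /=].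
  by case=> -[d /IH /andP[d0 d1] <-]; lra.
case=> -[c cn <-]; have /andP[c0 c1] := stage01 _ _ cn; rewrite /tripling.
  have -> : c / 3 <= 1/2 by lra.
  have -> : 3 * (c / 3) = c by lra.
  by split=> //; [lra|apply/orP; left; lra].
have -> : ((2 + c) / 3 <= 1/2) = false by apply/negbTE; rewrite -ltNge; lra.
have -> : 3 * ((2 + c) / 3) - 2 = c by lra.
by split=> //; [lra|apply/orP; right; lra].
Qed.

Lemma ternary_set_tripling x : ternary_set R x -> ternary_set R (tripling x).
Proof. by move=> xT n _; have [] := cantor_stageS_tripling (xT n.+1 I). Qed.

Lemma ternary_set_iter n x :
  ternary_set R x -> ternary_set R (iter n tripling x).
Proof. by move=> xT; elim: n => //= n; exact: ternary_set_tripling. Qed.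

(** Either both points lie in the same third, where the map has slope 3, or the
removed middle third separates them. *)
Lemma tripling_dist x y : ternary_set R x -> ternary_set R y ->
  if (1/2 < x) == (1/2 < y) then `|tripling x - tripling y| = 3 * `|x - y|
  else 1/3 <= `|x - y|.
Proof.
move=> xT yT; rewrite /tripling !(leNgt _ (1/2)).
have [_ _ xgap] := cantor_stageS_tripling (xT 1%N I).
have [_ _ ygap] := cantor_stageS_tripling (yT 1%N I).
have E : 3 * `|x - y| = `|3 * (x - y)|.
  by rewrite normrM ger0_norm.
case: ltP => x2; case: ltP => y2 /=; rewrite ?E.
- by congr (`|_|); lra.
- by rewrite ler_normr; apply/orP; left; case/orP: ygap; case/orP: xgap; lra.
- by rewrite ler_normr; apply/orP; right; case/orP: ygap; case/orP: xgap; lra.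
- by congr (`|_|); lra.
Qed.

Lemma iter_tripling_dist n x y : ternary_set R x -> ternary_set R y ->
  (forall k, (k < n)%N -> ternary_digit x k = ternary_digit y k) ->
  `|iter n tripling x - iter n tripling y| = 3 ^+ n * `|x - y|.
Proof.
move=> xT yT; elim: n => [|n IH] xy; first by rewrite mul1r.
have := tripling_dist (ternary_set_iter n xT) (ternary_set_iter n yT).
rewrite (_ : (_ == _) = true) /=; last by rewrite -!/(ternary_digit _ _) xy// eqxx.
by move=> ->; rewrite IH ?exprS ?mulrA// => k kn; apply: xy; exact: ltnW.
Qed.

Lemma ternary_digit_continuous n x y : ternary_set R x -> ternary_set R y ->
  `|x - y| < 3^-1 ^+ n ->
  forall k, (k < n)%N -> ternary_digit x k = ternary_digit y k.
Proof.
move=> xT yT xyn; elim: n xyn => // n IH xyn.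
have p3 : (0 : R) < 3^-1 ^+ n by apply: exprn_gt0; lra.
have {}IH k : (k < n)%N -> ternary_digit x k = ternary_digit y k.
  by apply: IH; move: xyn; rewrite exprS; lra.
move=> k; rewrite ltnS leq_eqVlt => /predU1P[->|]; last exact: IH.
apply/eqP; rewrite /ternary_digit.
have := tripling_dist (ternary_set_iter n xT) (ternary_set_iter n yT).
case: ifP => // _; rewrite iter_tripling_dist//.
have : 3 ^+ n * `|x - y| < 3 ^+ n * 3^-1 ^+ n.+1.
  by rewrite ltr_pM2l ?exprn_gt0.
rewrite exprSr mulrA -exprMn divff// expr1n; lra.
Qed.

(** Points with the same itinerary stay within distance 1 of each other while
their distance is tripled at each step. *)
Lemma ternary_digit_inj x y : ternary_set R x -> ternary_set R y ->
  ternary_digit x = ternary_digit y -> x = y.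
Proof.
move=> xT yT xy; apply/eqP; rewrite -subr_eq0 -normr_eq0.
apply/negPn/negP => xy0.
have d0 : 0 < `|x - y| by rewrite lt_neqAle eq_sym xy0 normr_ge0.
pose n := Num.truncn (`|x - y|^-1).
have : 3 ^+ n.+1 * `|x - y| <= 1.
  rewrite -iter_tripling_dist// => [|k _]; last by rewrite xy.
  have := ternary_set_unit (ternary_set_iter n.+1 xT).
  have := ternary_set_unit (ternary_set_iter n.+1 yT).
  by rewrite ler_norml; lra.
rewrite -ler_pdivlMr// div1r leNgt => /negP; apply.
apply: lt_le_trans (truncnS_gt _) _.
by rewrite -natrX ler_nat ltnW// ltn_expl.
Qed.

Lemma ternary_set_compact : compact (ternary_set R).
Proof.
have stage_compact n : compact (cantor_stage R n).
  elim: n => [|n IH] /=; first exact: segment_compact.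
  apply: compactU; apply: continuous_compact => //;
    apply: continuous_subspaceT => x.
    by apply: cvgM; [exact: cvg_id|exact: cvg_cst].
  apply: cvgM; last exact: cvg_cst.
  by apply: cvgD; [exact: cvg_cst|exact: cvg_id].
apply: (subclosed_compact _ (stage_compact 0%N)); last by move=> x /(_ 0%N I).
by apply: closed_bigI => n _; apply: compact_closed.
Qed.

Lemma ternary_set01 : ternary_set R 0 /\ ternary_set R 1.
Proof.
split=> n _; elim: n => [|n IH] /=.
- by apply/unit_intervalP; rewrite lexx ler01.
- by left; exists 0 => //; lra.
- by apply/unit_intervalP; rewrite lexx ler01.
- by right; exists 1 => //; lra.
Qed.

End ternary_digits.

(** * Cantor sets as images of the ternary set *)

Section cantor_images.
Context {R : realType} {Y : metricType R}.

(** The inverse is continuous because the ternary set is compact: otherwise some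
sequence would stay away from [x] while its images tend to [phi x], and a
cluster point of it would contradict injectivity. *)
Lemma cantor_set_image (phi : R -> Y) :
  (forall (x e : R), ternary_set R x -> 0 < e -> exists2 d : R, 0 < d &
     forall y, ternary_set R y -> `|x - y| < d -> mdist (phi x) (phi y) < e) ->
  (forall x y, ternary_set R x -> ternary_set R y -> phi x = phi y -> x = y) ->
  is_cantor_set R (phi @` ternary_set R).
Proof.
move=> phic phii.
have [psi psiK] : exists psi : Y -> R, forall x, ternary_set R x ->
    psi (phi x) = x.
  have H y : exists x, (phi @` ternary_set R) y -> ternary_set R x /\ phi x = y.
    have [[x xT xy]|yK] := pselect ((phi @` ternary_set R) y).
      by exists x.
    by exists 0 => /yK.
  have [psi psiP] := choice H.
  exists psi => x xT; have [pT pK] := psiP (phi x) (imageP _ xT).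
  exact: phii.
exists phi, psi; split.
- by move=> x xT; exists x.
- by move=> _ [x xT <-] /=; rewrite psiK.
- split=> [x /set_mem|_ /set_mem[x xT <-]]; first exact: psiK.
  by rewrite /= psiK.
- apply/subspace_continuousP => x xT.
  apply/metricType_numDomainType.cvgrPdist_lt => e e0.
  have [d d0 H] := phic _ _ xT e0.
  by exists d => // y /= xy yT; exact: H.
- apply/subspace_continuousP => _ [x xT <-]; apply/cvgrPdist_lt => e e0.
  rewrite /from_subspace psiK//.
  have [d d0 H] : exists2 d, 0 < d & forall y, ternary_set R y ->
      mdist (phi x) (phi y) < d -> `|x - y| < e.
    apply: contrapT => /forall2NP noM.
    have {noM} H n : exists y, [/\ ternary_set R y,
        mdist (phi x) (phi y) < n.+1%:R^-1 & e <= `|x - y|].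
      have [|/existsNP[y /not_implyP[yT /not_implyP[xy /negP]]]] :=
          noM n.+1%:R^-1; first by rewrite invr_gt0.
      by rewrite -leNgt => ?; exists y.
    have [u uP] := choice H.
    have [z zT zu] : exists2 z, ternary_set R z & forall (d : R) N, 0 < d ->
        exists2 n, (N <= n)%N & `|z - u n| < d.
      have uT n : ternary_set R (u n) by have [] := uP n.
      have [z zT zu] := @compact_seq_cluster R R^o _ u ternary_set_compact uT.
      exists z => // d N d0; have [n Nn zn] := zu d N d0.
      by exists n => //; rewrite distrC; exact: zn.
    suff xz : x = z.
      have [n _] := zu e 0%N e0; rewrite -xz ltNge.
      by have [_ _ ->] := uP n.
    apply: phii => //; apply: mdist_positivity; apply/eqP; rewrite eq_le.
    rewrite mdist_ge0 andbT; apply/ler_addgt0Pr => b b0; rewrite add0r.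
    have [d d0 zd] := phic z (b / 2) zT ltac:(lra).
    have [n Nn zn] := zu d (Num.truncn ((b / 2)^-1)) d0.
    have [uT xu _] := uP n.
    have {}zn := zd _ uT zn.
    have nb : n.+1%:R^-1 < b / 2 by apply: invSn_lt => //; rewrite divr_gt0.
    apply: le_trans (mdist_triangle_mid (phi (u n)) _ _) _.
    rewrite (mdistC (phi (u n))) (splitr b) ltW// ltrD//.
    exact: lt_trans xu nb.
  apply/nbhs_ballP; exists d => //= y; rewrite ballEmdist /= => xy [z zT zy].
  by move: xy; rewrite -zy psiK// => /(H _ zT).
Qed.

(** The digits inject the ternary set continuously into the binary sequences, so
composing [F] with them gives a parametrization by the ternary set. *)
Lemma cantor_set_branches (F : (nat -> bool) -> Y) :
  (forall s e, 0 < e -> exists n, forall t,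
     (forall k, (k < n)%N -> s k = t k) -> mdist (F s) (F t) < e) ->
  injective F ->
  is_cantor_set R [set F (ternary_digit x) | x in ternary_set R].
Proof.
move=> Fc Fi; apply: cantor_set_image => [x e xT e0|x y xT yT /Fi].
  have [n H] := Fc (ternary_digit x) e e0.
  exists (3^-1 ^+ n); first by rewrite exprn_gt0.
  by move=> y yT xy; apply: H; exact: ternary_digit_continuous.
exact: ternary_digit_inj.
Qed.

Lemma cantor_set_two_points (K : set Y) : is_cantor_set R K ->
  exists x y, [/\ K x, K y & x <> y].
Proof.
move=> [phi [psi [phiK _ [cK _] _ _]]].
have [T0 T1] := @ternary_set01 R.
exists (phi 0), (phi 1); split; [exact: phiK|exact: phiK|].
by move=> /(congr1 psi); rewrite !cK ?inE// => /eqP; rewrite eq_sym oner_eq0.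
Qed.

End cantor_images.

(** * Mycielski sets in complete metric spaces *)

Section metric_completeness.
Context {R : realType} {Y : metricType R}.

Lemma metric_completeP : metric_complete Y <->
  forall u : nat -> Y,
    (forall e : R, 0 < e -> exists N, forall n m, (N <= n)%N -> (N <= m)%N ->
       mdist (u n) (u m) < e) ->
    exists l, forall e : R, 0 < e -> exists N, forall n, (N <= n)%N ->
       mdist l (u n) < e.
Proof.
split=> [Yc u uC|H u /cauchyP uC].
- have /Yc[l ul] : cauchy (u @ \oo).
    apply/cauchyP => e e0; have [N NP] := uC e e0.
    exists (u N); exists N => // n /= Nn; rewrite ballEmdist /=.
    exact: NP.
  exists l => e e0.
  have [N _ NP] := (metricType_numDomainType.cvgrPdist_lt u l).1 ul e e0.
  by exists N => n Nn; exact: NP.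
- have [|l lP] := H u.
    move=> e e0; have [|x [N _ NP]] := uC (e / 2); first by rewrite divr_gt0.
    have {}NP n : (N <= n)%N -> mdist x (u n) < e / 2.
      by move=> Nn; have := NP n Nn; rewrite /= ballEmdist.
    exists N => n m Nn Nm.
    apply: le_lt_trans (mdist_triangle_mid x _ _) _.
    by rewrite (mdistC (u n)) (splitr e) ltrD ?NP.
  exists l; apply/metricType_numDomainType.cvgrPdist_lt => e e0.
  by have [N NP] := lP e e0; exists N => // n /= Nn; exact: NP.
Qed.

End metric_completeness.

Section mycielski.
Context {R : realType} {Y : metricType R}.

Definition nonempty_open (U : set Y) := open U /\ U !=set0.

(** Equivalently, [P] contains a dense open subset of the square of [Y].  The
formulation with boxes is the one used when cells are shrunk. *)
Definition dense_open_rel (P : Y -> Y -> Prop) :=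
  forall U V, nonempty_open U -> nonempty_open V ->
  exists U' V', [/\ nonempty_open U' /\ nonempty_open V', U' `<=` U, V' `<=` V &
    forall x y, U' x -> V' y -> P x y].

Lemma dense_open_relI P Q : dense_open_rel P -> dense_open_rel Q ->
  dense_open_rel (fun x y => P x y /\ Q x y).
Proof.
move=> dP dQ U V oU oV; have [U1 [V1 [[oU1 oV1] U1U V1V P1]]] := dP _ _ oU oV.
have [U2 [V2 [UV2 U2U V2V Q2]]] := dQ _ _ oU1 oV1.
exists U2, V2; split => //.
- exact: subset_trans U1U.
- exact: subset_trans V1V.
- by move=> x y Ux Vy; split; [apply: P1; [exact: U2U|exact: V2V]|exact: Q2].
Qed.

(** Treating the pairs of [L] one after the other is enough, since shrinking the
cells later preserves the relations already obtained. *)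
Lemma refine_pairs (J : eqType) (P : Y -> Y -> Prop) (L : seq (J * J))
    (W : J -> set Y) :
  dense_open_rel P -> (forall i, nonempty_open (W i)) ->
  exists W' : J -> set Y,
    [/\ forall i, nonempty_open (W' i), forall i, W' i `<=` W i &
        forall i k, (i, k) \in L -> i != k ->
          forall x y, W' i x -> W' k y -> P x y].
Proof.
move=> dP; elim: L W => [|[i k] L IH] W oW.
  by exists W; split => [//|i|//]; exact: subset_refl.
have [U [V [[oU oV] UW VW UV]]] := dP _ _ (oW i) (oW k).
pose W1 l := if l == i then U else if l == k then V else W l.
have oW1 l : nonempty_open (W1 l) by rewrite /W1; case: eqP => // _; case: eqP.
have W1W l : W1 l `<=` W l.
  rewrite /W1; have [->//|_] := eqVneq l i; have [->//|_] := eqVneq l k.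
  exact: subset_refl.
have [W' [oW' W'W1 W'P]] := IH W1 oW1.
exists W'; split => // [l|i1 k1].
  exact: subset_trans (W1W l).
rewrite in_cons => /predU1P[[-> ->] ik x y|]; last exact: W'P.
move=> /W'W1 + /W'W1; by rewrite /W1 eqxx eq_sym (negbTE ik) eqxx; exact: UV.
Qed.

Lemma shrink_ball (U : set Y) (e : R) : nonempty_open U -> 0 < e ->
  exists c : Y * R, [/\ 0 < c.2, c.2 <= e &
    forall y, mdist c.1 y <= c.2 -> U y].
Proof.
move=> [oU [p Up]] e0.
have /nbhs_ballP[d d0 dU] : nbhs p U by exact: open_nbhs_nbhs.
exists (p, Num.min e (d / 2)); split => /=.
- by rewrite lt_min e0 divr_gt0.
- by rewrite ge_min lexx.
- move=> y; rewrite le_min => /andP[_ py]; apply: dU; rewrite ballEmdist /=.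
  by apply: le_lt_trans py _; rewrite ltr_pdivrMr// ltr_pMr// ltr1n.
Qed.

Lemma nonempty_open_ball (p : Y) (e : R) : 0 < e -> nonempty_open (ball p e).
Proof.
move=> e0; split; last by exists p; exact: ballxx.
rewrite openE => y; rewrite ballEmdist /= => py; apply/nbhs_ballP.
exists (e - mdist p y); first by rewrite /= subr_gt0.
move=> z; rewrite !ballEmdist /= ltrBrDl.
exact/le_lt_trans/metric_triangle.
Qed.

(** The construction: [c n (j, s)] is the centre and the radius of the cell of
stage [n] that is reached from the [j]-th open set by the binary word [s].  Only
words of length [n] matter at stage [n]; at stage [n.+1] all the cells of the
first [n.+1] trees are separated from each other by [P n], so that each tree is
subject to all but finitely many of the relations. *)
Section branches.
Variable P : nat -> Y -> Y -> Prop.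
Hypothesis P_dense : forall n, dense_open_rel (P n).

Definition words (n : nat) : seq (nat * seq bool) :=
  [seq (j, tval s) | j <- iota 0 n.+1, s <- enum {: n.+1.-tuple bool}].

Lemma mem_words n j s : (j <= n)%N -> size s = n.+1 -> (j, s) \in words n.
Proof.
move=> jn /eqP sn; apply/allpairsP; exists (j, Tuple sn).
by split; rewrite ?mem_iota ?mem_enum.
Qed.

Definition refines n (c c' : nat * seq bool -> Y * R) :=
  [/\ forall i, 0 < (c' i).2,
      forall i, (c' i).2 <= n.+1%:R^-1,
      forall j s y, mdist (c' (j, s)).1 y <= (c' (j, s)).2 ->
        mdist (c (j, take n s)).1 y < (c (j, take n s)).2 &
      forall i k, i \in words n -> k \in words n -> i != k ->
        forall x y, mdist (c' i).1 x < (c' i).2 -> mdist (c' k).1 y < (c' k).2 ->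
        P n x y].

Lemma refines_exists n c : (forall i, 0 < (c i).2) -> exists c', refines n c c'.
Proof.
move=> c0.
pose W (i : nat * seq bool) := ball (c (i.1, take n i.2)).1 (c (i.1, take n i.2)).2.
have oW i : nonempty_open (W i) by exact: nonempty_open_ball.
have [W' [oW' W'W W'P]] :=
  refine_pairs [seq (i, k) | i <- words n, k <- words n] (P_dense n) oW.
have n0 : (0 : R) < n.+1%:R^-1 by rewrite invr_gt0.
have [c' c'P] := choice (fun i => shrink_ball (oW' i) n0).
exists c'; split => [i|i|j s y|i k iw kw ik x y].
- by have [] := c'P i.
- by have [] := c'P i.
- have [_ _ ci] := c'P (j, s); move=> /ci/W'W.
  by rewrite /W ballEmdist.
- have [_ _ ci] := c'P i; have [_ _ ck] := c'P k => /ltW/ci ? /ltW/ck ?.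
  apply: W'P ik _ _ _ _ => //.
  by apply/allpairsP; exists (i, k).
Qed.

Hypothesis Y_complete : metric_complete Y.

(** [F j s] is the common point of the nested cells along the branch [s] of the
[j]-th tree. *)
Lemma branches_exist (U : nat -> set Y) :
  (forall j, nonempty_open (U j)) ->
  exists F : nat -> (nat -> bool) -> Y,
    [/\ forall j s, U j (F j s),
        forall j s e, 0 < e -> exists n, forall t,
          (forall k, (k < n)%N -> s k = t k) -> mdist (F j s) (F j t) < e &
        forall j s k t, (j, s) <> (k, t) ->
          exists N, forall n, (N <= n)%N -> P n (F j s) (F k t)].
Proof.
move=> oU; have [c0 c0P] := choice (fun j => shrink_ball (oU j) ltr01).
have next_ex (nc : nat * (nat * seq bool -> Y * R)) : exists c',
    (forall i, 0 < (nc.2 i).2) -> refines nc.1 nc.2 c'.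
  have [H|H] := pselect (forall i, 0 < (nc.2 i).2); last by exists nc.2 => /H.
  by have [c' c'P] := refines_exists nc.1 H; exists c'.
have [next nextP] := choice next_ex.
pose c := fix c n := if n is m.+1 then next (m, c m) else fun i => c0 i.1.
have c_pos n i : 0 < (c n i).2.
  elim: n i => [|n IH] i /=; first by have [] := c0P i.1.
  by have [] := nextP (n, c n) IH.
have cP n : refines n (c n) (c n.+1) := nextP (n, c n) (c_pos n).
have c0U j s y : mdist (c 0%N (j, s)).1 y < (c 0%N (j, s)).2 -> U j y.
  by move=> /ltW; have [_ _] := c0P j; exact.
(* From here on, only the properties of the stages are used. *)
move: c c_pos cP c0U => {c0 c0P next nextP next_ex} c c_pos cP c0U.
pose x j s n := (c n (j, mkseq s n)).1; pose r j s n := (c n (j, mkseq s n)).2.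
have r_pos j s n : 0 < r j s n by exact: c_pos.
have r_le j s n : r j s n.+1 <= n.+1%:R^-1 by have [_ + _ _] := cP n; exact.
have x_nest j s n y : mdist (x j s n.+1) y <= r j s n.+1 ->
    mdist (x j s n) y < r j s n.
  have [_ _ + _] := cP n => /(_ j (mkseq s n.+1) y).
  by rewrite (_ : take n _ = mkseq s n)// /mkseq -map_take take_iota (minn_idPl _).
have x_in j s n m y : (n <= m)%N -> mdist (x j s m) y < r j s m ->
    mdist (x j s n) y < r j s n.
  move=> nm; elim: m nm => [|m IH]; first by rewrite leqn0 => /eqP ->.
  rewrite leq_eqVlt => /predU1P[->//|nm] /ltW/x_nest; exact: IH.
have inv_small (e : R) : 0 < e -> exists N, forall n, (N <= n)%N ->
    n.+1%:R^-1 < e.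
  by move=> e0; exists (Num.truncn e^-1) => n; exact: invSn_lt.
have x_lim j s : exists l, forall n, mdist (x j s n) l < r j s n.
  have xx n m : (n <= m)%N -> mdist (x j s n) (x j s m) < r j s n.
    by move=> nm; apply: x_in nm _; rewrite mdistxx.
  have [|l lP] := metric_completeP.1 Y_complete (x j s).
    move=> e e0; have [N NP] := inv_small (e / 2) ltac:(lra).
    exists N.+1 => n m Nn Nm; apply: le_lt_trans (mdist_triangle_mid (x j s N.+1) _ _) _.
    rewrite (splitr e) (mdistC (x j s n)) ltrD//;
      (apply: lt_le_trans (xx _ _ _) _ => //; apply: le_trans (r_le _ _ _) _);
      exact/ltW/NP.
  exists l => n; apply: x_nest; apply/ler_addgt0Pr => e e0.
  have [N NP] := lP e e0.
  apply: le_trans (mdist_triangle_mid (x j s (maxn N n.+1)) _ _) _.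
  rewrite lerD// ?ltW ?xx ?leq_maxr//.
  by rewrite mdistC NP// leq_maxl.
have [F FP] : exists F : nat -> (nat -> bool) -> Y,
    forall j s n, mdist (x j s n) (F j s) < r j s n.
  have [F FP] := choice (fun js => x_lim js.1 js.2).
  by exists (fun j s => F (j, s)) => j s; exact: (FP (j, s)).
exists F; split => [j s|j s e e0|j s k t jskt].
- exact: c0U (FP j s 0%N).
- have [N NP] := inv_small (e / 2) ltac:(lra).
  exists N.+1 => t st.
  have E : mkseq s N.+1 = mkseq t N.+1.
    by apply/eq_in_map => k; rewrite mem_iota => /andP[_]; exact: st.
  have sN := FP j s N.+1; have tN := FP j t N.+1.
  rewrite /x /r -E in tN.
  apply: le_lt_trans (mdist_triangle_mid (x j s N.+1) _ _) _.
  rewrite (splitr e) (mdistC (F j s)) ltrD//;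
    (apply: lt_le_trans; [eassumption|apply: le_trans (r_le _ _ _) _]);
    exact/ltW/NP.
(* Distinct branches have distinct prefixes from the first place where they
   differ on, and a tree takes part in the separation from the stage given by
   its index on. *)
- have [N NP] : exists N, forall n, (N <= n)%N -> [/\ (j <= n)%N, (k <= n)%N &
      (j, mkseq s n.+1) != (k, mkseq t n.+1)].
    have [jk|jk] := eqVneq j k; last first.
      exists (maxn j k) => n; rewrite geq_max => /andP[jn kn]; split => //.
      by apply/eqP => -[/eqP]; rewrite (negbTE jk).
    have /existsNP[q sq] : ~ (forall q, s q = t q).
      by move=> /funext st; apply: jskt; rewrite jk st.
    exists (maxn j q) => n; rewrite geq_max => /andP[jn qn]; rewrite -jk; split => //.
    apply/eqP => /(congr1 (fun i => nth false i.2 q)) /=.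
    by rewrite !nth_mkseq.
  exists N => n /NP[jn kn ne].
  have [_ _ _ cPn] := cP n.
  apply: (cPn _ _ _ _ ne); [| |exact: (FP j s n.+1)|exact: (FP k t n.+1)].
    by apply: mem_words; rewrite ?size_mkseq.
  by apply: mem_words; rewrite ?size_mkseq.
Qed.

(** Irreflexivity of the relations makes the branch maps injective: it plays
the part of the absence of isolated points in the classical statement. *)
Theorem mycielski (U : nat -> set Y) :
  (forall n x, ~ P n x x) -> (forall j, nonempty_open (U j)) ->
  exists K : nat -> set Y,
    [/\ forall j, is_cantor_set R (K j), forall j, K j `<=` U j &
        forall x y, (\bigcup_j K j) x -> (\bigcup_j K j) y -> x <> y ->
          exists N, forall n, (N <= n)%N -> P n x y].
Proof.
move=> Pirr /branches_exist[F [FU Fc FP]].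
exists (fun j => [set F j (ternary_digit x) | x in ternary_set R]); split.
- move=> j; apply: cantor_set_branches => [|s t Fst]; first exact: Fc.
  apply: contrapT => st.
  have [|N /(_ N (leqnn N))] := FP j s j t; first by case.
  by rewrite Fst => /Pirr.
- by move=> j _ [x _ <-].
- move=> _ _ [j _ [x _ <-]] [k _ [y _ <-]] xy.
  by apply: FP => -[jk xyd]; apply: xy; rewrite jk xyd.
Qed.

End branches.
End mycielski.

(** * A criterion for Cantor-dense Li-Yorke chaos *)

Section chaos_criterion.
Context {R : realType} {Y : metricType R} (g : Y -> Y).
Hypothesis g_continuous : continuous g.

Lemma iter_continuous_mdist n (x : Y) (e : R) : 0 < e -> exists2 d : R, 0 < d &
  forall y, mdist x y < d -> mdist (iter n g x) (iter n g y) < e.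
Proof.
move=> e0; have itc : continuous (iter n g).
  elim: n => [|n IH] y; first exact: cvg_id.
  by apply: (@continuous_comp _ _ _ (iter n g) g); [exact: IH|exact: g_continuous].
have /nbhs_ballP[d d0 dP] :
    nbhs x [set y | mdist (iter n g x) (iter n g y) < e].
  exact: (metricType_numDomainType.cvgrPdist_lt _ _).1 (itc x) e e0.
by exists d => // y xy; apply: dP; rewrite ballEmdist.
Qed.

Lemma dense_open_rel_iter N (Q : set R) : open Q ->
  (forall U V, nonempty_open U -> nonempty_open V -> exists x y,
     [/\ U x, V y & exists2 n, (N <= n)%N & Q (mdist (iter n g x) (iter n g y))]) ->
  dense_open_rel (fun x y =>
    exists2 n, (N <= n)%N & Q (mdist (iter n g x) (iter n g y))).
Proof.
move=> oQ H U V oU oV; have [x [y [Ux Vy [n Nn Qxy]]]] := H _ _ oU oV.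
have /nbhs_ballP[e /= e0 eQ] := open_nbhs_nbhs (conj oQ Qxy).
have e20 : 0 < e / 2 by rewrite divr_gt0.
have [dx dx0 xP] := iter_continuous_mdist n x e20.
have [dy dy0 yP] := iter_continuous_mdist n y e20.
exists (U `&` ball x dx), (V `&` ball y dy).
have cap W z d : nonempty_open W -> W z -> 0 < d -> nonempty_open (W `&` ball z d).
  move=> oW Wz d0; split; last by exists z; split => //; exact: ballxx.
  by apply: openI; [case: oW|case: (nonempty_open_ball z d0)].
split; [by split; apply: cap|exact: subIsetl|exact: subIsetl|].
move=> x' y' [_]; rewrite ballEmdist /= => /xP xx' [_].
rewrite ballEmdist /= => /yP yy'; exists n => //; apply: eQ.
rewrite /ball /= [e]splitr.
by apply: le_lt_trans (mdist_distl _ _ _ _) _; rewrite ltrD.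
Qed.

(** It is enough to find, in any two open sets, one pair that is close at some
late time and another pair that is far apart at some late time: both conditions
are open, so for each [n] the pairs satisfying both conditions at times from
[n] on form a dense open relation, and Li-Yorke pairs are those that satisfy
infinitely many of these relations. *)
Theorem frequently_near_far_CD_LYC (e : R) : metric_complete Y -> 0 < e ->
  (forall U V, nonempty_open U -> nonempty_open V -> forall (d : R) N, 0 < d ->
     exists x y, [/\ U x, V y & exists2 n, (N <= n)%N &
       mdist (iter n g x) (iter n g y) < d]) ->
  (forall U V, nonempty_open U -> nonempty_open V -> forall N,
     exists x y, [/\ U x, V y & exists2 n, (N <= n)%N &
       e < mdist (iter n g x) (iter n g y)]) ->
  CD_LYC Y g.
Proof.
move=> Yc e0 near_ far_; exists e => // U oU U0.
pose P n x y :=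
  (exists2 m, (n <= m)%N & mdist (iter m g x) (iter m g y) < n.+1%:R^-1) /\
  (exists2 m, (n <= m)%N & e < mdist (iter m g x) (iter m g y)).
have P_dense n : dense_open_rel (P n).
  apply: dense_open_relI.
    apply: (dense_open_rel_iter (Q := [set a | a < n.+1%:R^-1])) => [|A B oA oB].
      exact: open_lt.
    by apply: near_ => //; rewrite invr_gt0.
  apply: (dense_open_rel_iter (Q := [set a | e < a])) => [|A B oA oB].
    exact: open_gt.
  exact: far_.
have Pirr n x : ~ P n x x.
  by move=> [_ [m _]]; rewrite mdistxx => /(lt_trans e0); rewrite ltxx.
have [K [Kc KU KP]] := mycielski P_dense Yc Pirr (fun j => conj (oU j) (U0 j)).
exists K; split => // x y Kx Ky xy.
have [N NP] := KP _ _ Kx Ky xy; split.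
  apply/le_limn_esupP => a M ae.
  have [_ [m Mm em]] := NP (maxn N M) (leq_maxl _ _).
  exists m; first exact: leq_trans (leq_maxr _ _) Mm.
  exact: lt_trans em.
apply/limn_einf_eq0P => [n|d M d0]; first exact: mdist_ge0.
pose n := maxn (maxn N M) (Num.truncn d^-1).
have [[m nm md] _] := NP n (leq_trans (leq_maxl _ _) (leq_maxl _ _)).
exists m; first by apply: leq_trans nm; rewrite /n !leq_max leqnn orbT.
by apply: lt_trans md _; apply: invSn_lt; rewrite ?leq_maxr.
Qed.

End chaos_criterion.

(** * The hyperspace of compact sets *)

Section hyperspace_distance.
Context {R : realType} {X : metricType R}.
Implicit Types A B : compact_set X.

Lemma dH_leP A B (e : R) : mdist A B <= e <->
  forall r, e < r -> (forall x, cset A x -> exists2 y, cset B y & mdist x y < r) /\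
                     (forall y, cset B y -> exists2 x, cset A x & mdist y x < r).
Proof.
apply: (hausdorff_dist_le (@mdistxx _ X) (@mdistC _ X) mdist_triangle_mid);
  by [exact: cset_neq0|apply: compact_dbounded; [exact: cset_compact|exact: cset_neq0]].
Qed.

Lemma dH_le A B (e : R) :
  (forall x, cset A x -> exists2 y, cset B y & mdist x y < e) ->
  (forall y, cset B y -> exists2 x, cset A x & mdist y x < e) -> mdist A B <= e.
Proof.
move=> AB BA; apply/dH_leP => r er; split=> [x /AB|y /BA] [z Cz xz];
  by exists z => //; exact: lt_trans er.
Qed.

Lemma dH_lt A B (e : R) : mdist A B < e ->
  forall x, cset A x -> exists2 y, cset B y & mdist x y < e.
Proof. by move=> ABe x Ax; have /dH_leP/(_ _ ABe)[+ _] := lexx (mdist A B); exact. Qed.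

End hyperspace_distance.

Section hyperspace_complete.
Context {R : realType} {X : metricType R}.

Lemma exp_half_lt (e : R) : 0 < e -> exists k, (2^-1 : R) ^+ k < e.
Proof.
move=> e0; exists (Num.truncn e^-1).
rewrite exprVn invf_plt ?posrE ?exprn_gt0//.
apply: lt_le_trans (truncnS_gt _) _.
by rewrite -natrX ler_nat ltn_expl.
Qed.

(** Completeness is a statement about sequences, while the compactness of the
limit of compact sets will be read on ultrafilters. *)
Lemma metric_complete_filter (F : set_system X) : metric_complete X ->
  ProperFilter F -> cauchy_ex F -> exists l : X, F --> l.
Proof.
move=> /metric_completeP Xc FF FC.
have [z zP] := choice (fun k => FC ((2^-1 : R) ^+ k) ltac:(by rewrite exprn_gt0 ?invr_gt0)).
have zz k n : (k <= n)%N -> mdist (z k) (z n) < 2 * 2^-1 ^+ k.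
  move=> kn; have [x []] := filter_ex (filterI (zP k) (zP n)).
  rewrite !ballEmdist /= => kx nx.
  apply: le_lt_trans (mdist_triangle_mid x _ _) _.
  rewrite mulr_natl mulr2n ltrD// mdistC.
  by apply: lt_le_trans nx _; rewrite ler_wiXn2l// ?invr_ge0// invf_le1// ler1n.
have [|l lP] := Xc z.
  move=> e e0; have [k ke] := @exp_half_lt (e / 4) ltac:(lra).
  exists k => n m kn km; apply: le_lt_trans (mdist_triangle_mid (z k) _ _) _.
  have := zz _ _ kn; have := zz _ _ km; rewrite (mdistC (z n)); lra.
exists l => B /nbhs_ballP[e /= e0 eB].
have [k ke] := @exp_half_lt (e / 4) ltac:(lra).
have [N NP] := lP (e / 4) ltac:(lra).
apply: filterS (zP k) => x; rewrite ballEmdist /= => kx; apply: eB.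
rewrite ballEmdist /=.
have := NP _ (leq_maxl N k); have := zz _ _ (leq_maxr N k).
have := mdist_triangle_mid (z k) l x; have := mdist_triangle_mid (z (maxn N k)) l (z k).
rewrite (mdistC (z (maxn N k))); lra.
Qed.

Hypothesis X_complete : metric_complete X.

Section limit.
Variable A : nat -> compact_set X.
Hypothesis A_cauchy : forall e : R, 0 < e -> exists N, forall n m,
  (N <= n)%N -> (N <= m)%N -> mdist (A n) (A m) < e.

(** The lower Kuratowski limit, which for a Cauchy sequence is the limit for the
Hausdorff distance. *)
Definition limit_set : set X := [set x | forall e : R, 0 < e ->
  exists N, forall n, (N <= n)%N -> exists2 y, cset (A n) y & mdist x y < e].

Let tail N (e : R) := forall n m, (N <= n)%N -> (N <= m)%N -> mdist (A n) (A m) < e.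

Lemma limit_set_near N e x : 0 < e -> tail N e -> limit_set x ->
  exists2 y, cset (A N) y & mdist x y < 2 * e.
Proof.
move=> e0 Ne Lx; have [M MP] := Lx e e0.
have [y Ay xy] := MP _ (leq_maxl M N).
have [z Az yz] := dH_lt (Ne _ _ (leq_maxr M N) (leqnn N)) Ay.
by exists z => //; apply: le_lt_trans (mdist_triangle_mid y _ _) _; lra.
Qed.

(** A point of [A N] is followed through later members of the sequence, chosen
so sparsely that the successive jumps are halved; its trajectory converges. *)
Lemma near_limit_set N e y : 0 < e -> tail N e -> cset (A N) y ->
  exists2 x, limit_set x & mdist y x <= 2 * e.
Proof.
move=> e0 Ne Ay.
(* [h k] bounds the [k]-th jump, hence [2 * h k] all that remain after it. *)
pose h k : R := e * 2^-1 ^+ k.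
have h0 k : 0 < h k by rewrite mulr_gt0// exprn_gt0// invr_gt0.
have hS k : h k.+1 = h k / 2 by rewrite /h exprSr mulrA.
have h_small (d : R) : 0 < d -> exists k, h k < d.
  move=> d0; have [k kd] := exp_half_lt (divr_gt0 d0 e0).
  by exists k; rewrite /h mulrC -ltr_pdivlMr.
have hE : h 0%N = e by rewrite /h mulr1.
clearbody h.
have [nu nuP] := choice (fun k => A_cauchy (h0 k)).
pose mu := fix mu k := if k is l.+1 then maxn (mu l) (nu k) else N.
have muP k : tail (mu k) (h k).
  case: k => [|k]; first by rewrite hE.
  by move=> n m /=; rewrite !geq_max => /andP[_ kn] /andP[_ km]; exact: nuP.
have muS k : (mu k <= mu k.+1)%N by exact: leq_maxl.
have next_ex (p : nat * X) : exists z, cset (A (mu p.1)) p.2 ->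
    cset (A (mu p.1.+1)) z /\ mdist p.2 z < h p.1.
  have [Ap|nAp] := pselect (cset (A (mu p.1)) p.2); last by exists p.2 => /nAp.
  have [z Az pz] := dH_lt (muP _ _ _ (leqnn (mu p.1)) (muS p.1)) Ap.
  by exists z.
have [next nextP] := choice next_ex.
pose u := fix u k := if k is l.+1 then next (l, u l) else y.
have uA k : cset (A (mu k)) (u k).
  by elim: k => // k IH /=; have [] := nextP (k, u k) IH.
have uu k : mdist (u k) (u k.+1) < h k by have [] := nextP (k, u k) (uA k).
have uE : u 0%N = y by [].
clearbody u.
have ukm k m : mdist (u k) (u (k + m)%N) <= 2 * h k - 2 * h (k + m)%N.
  elim: m => [|m IH]; first by rewrite addn0 mdistxx; lra.
  apply: le_trans (mdist_triangle_mid (u (k + m)%N) _ _) _.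
  by have := uu (k + m)%N; rewrite addnS hS; lra.
have {}ukm k n : (k <= n)%N -> mdist (u k) (u n) <= 2 * h k.
  by move=> kn; have := ukm k (n - k)%N; rewrite subnKC//; have := h0 n; lra.
have [|l lP] := metric_completeP.1 X_complete u.
  move=> d d0; have [k kd] := h_small (d / 4) ltac:(lra).
  exists k => n m kn km; apply: le_lt_trans (mdist_triangle_mid (u k) _ _) _.
  have := ukm _ _ kn; have := ukm _ _ km; rewrite (mdistC (u n)); lra.
have ul k : mdist (u k) l <= 2 * h k.
  apply/ler_addgt0Pr => d d0; have [M MP] := lP d d0.
  have := ukm _ _ (leq_maxr M k); have := MP _ (leq_maxl M k).
  have := mdist_triangle_mid (u (maxn M k)) (u k) l.
  by rewrite (mdistC (u (maxn M k))); lra.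
exists l; last by have := ul 0%N; rewrite hE uE.
move=> d d0; have [k kd] := h_small (d / 3) ltac:(lra).
exists (mu k) => n kn; have [z Az uz] := dH_lt (muP k _ _ (leqnn _) kn) (uA k).
exists z => //; have := mdist_triangle_mid (u k) l z; have := ul k.
by rewrite (mdistC _ l); lra.
Qed.

Lemma closed_limit_set : closed limit_set.
Proof.
move=> x clx; move=> e e0.
have e20 : 0 < e / 2 by lra.
have [y Ly xy] := closure_mdist clx e20; have [N NP] := Ly _ e20.
exists N => n /NP[z Az yz]; exists z => //.
by apply: le_lt_trans (mdist_triangle_mid y _ _) _; lra.
Qed.

Lemma limit_set_neq0 : limit_set !=set0.
Proof.
have [N NP] := A_cauchy ltr01; have [y Ay] := cset_neq0 (A N).
by have [x Lx _] := near_limit_set ltr01 NP Ay; exists x.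
Qed.

(** The limit set is closed and totally bounded.  Instead of finite coverings,
the compactness of a member [A N] close to it is used: an ultrafilter on the
limit set leaves a trace on a neighbourhood of it in [A N], and a cluster point
of the trace is the centre of a small ball of the ultrafilter, which is thus
Cauchy. *)
Lemma compact_limit_set : compact limit_set.
Proof.
rewrite compact_ultra => G GU GL.
have GC : cauchy_ex G.
  move=> e e0; pose d := e / 3; have d0 : 0 < d by rewrite /d; lra.
  have [N NP] := A_cauchy d0.
  pose trace (S : set X) := [set y | cset (A N) y /\ exists2 x, S x & mdist x y < 2 * d].
  have H_filter : ProperFilter (filter_from G trace).
    apply: filter_from_proper => [|S GS].
      apply: filter_from_filter; first by exists setT; exact: filterT.
      move=> S T GS GT; exists (S `&` T); first exact: filterI.
      by move=> y [Ay [x [Sx Tx] xy]]; split; split => //; exists x.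
    have [x [Sx Lx]] := filter_ex (filterI GS GL).
    by have [y Ay xy] := limit_set_near d0 NP Lx; exists y; split => //; exists x.
  have [|z [Az clz]] := @cset_compact _ _ (A N) _ H_filter.
    by exists setT; [exact: filterT|move=> y []].
  exists z; have [//|Gnz] := in_ultra_setVsetC (ball z e) GU.
  have Htrace : filter_from G trace (trace (~` ball z e)) by exists (~` ball z e).
  have [y [[_ [x zx xy]]]] := clz _ _ Htrace (nbhsx_ballx z d d0).
  rewrite ballEmdist /= => zy; case: zx; rewrite ballEmdist /=.
  apply: le_lt_trans (mdist_triangle_mid y _ _) _; rewrite (mdistC y).
  by rewrite /d in zy xy; lra.
have [l Gl] := metric_complete_filter X_complete _ GC.
exists l; split => //; apply: closed_limit_set => B /Gl GB.
exact: filter_ex (filterI GL GB).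
Qed.

Lemma limit_set_cvg (e : R) : 0 < e -> exists N, forall n, (N <= n)%N ->
  mdist (CompactSet compact_limit_set limit_set_neq0) (A n) < e.
Proof.
move=> e0; pose d := e / 4; have d0 : 0 < d by rewrite /d; lra.
have [N NP] := A_cauchy d0; exists N => n Nn.
have tn : tail n d by move=> m k nm nk; apply: NP; exact: leq_trans Nn _.
apply: (@le_lt_trans _ _ (3 * d)); last by rewrite /d; lra.
apply: dH_le => [x Lx|y Ay].
  by have [y Ay xy] := limit_set_near d0 tn Lx; exists y => //; lra.
by have [x Lx xy] := near_limit_set d0 tn Ay; exists x => //; lra.
Qed.

End limit.

Theorem metric_complete_hyperspace : metric_complete (compact_set X).
Proof.
apply/metric_completeP => A A_cauchy.
exists (CompactSet (compact_limit_set A_cauchy) (limit_set_neq0 A_cauchy)).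
exact: limit_set_cvg.
Qed.

End hyperspace_complete.

Section hyperextension_continuity.
Context {R : realType} {X : metricType R} (f : X -> X).
Hypothesis f_continuous : continuous f.

(** Stronger than uniform continuity on [K], as only [x] has to be in [K]; this
is what compares the images of [K] and of a compact set near [K]. *)
Lemma compact_uniform_continuity (K : set X) (e : R) : compact K -> 0 < e ->
  exists2 d : R, 0 < d &
    forall x y, K x -> mdist x y < d -> mdist (f x) (f y) < e.
Proof.
move=> cK e0; apply: contrapT => /forall2NP noM.
have {}noM n : exists xy : X * X, [/\ K xy.1, mdist xy.1 xy.2 < n.+1%:R^-1 &
    e <= mdist (f xy.1) (f xy.2)].
  have [|/existsNP[x /existsNP[y /not_implyP[Kx /not_implyP[xy /negP]]]]] :=
    noM n.+1%:R^-1; first by rewrite invr_gt0.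
  by rewrite -leNgt => ?; exists (x, y).
have [u uP] := choice noM.
have uK n : K (u n).1 by have [] := uP n.
have [z Kz zu] := compact_seq_cluster cK uK.
have [d d0 dP] := iter_continuous_mdist f_continuous 1 z (e := e / 2) ltac:(lra).
have [n Nn zn] := zu (d / 2) (Num.truncn (d / 2)^-1) ltac:(lra).
have [_ xy] := uP n; apply/negP; rewrite -ltNge.
have nd : n.+1%:R^-1 < d / 2 by apply: invSn_lt => //; rewrite divr_gt0.
have zy : mdist z (u n).2 < d.
  apply: le_lt_trans (mdist_triangle_mid (u n).1 _ _) _.
  by rewrite [d]splitr ltrD//; exact: lt_trans xy nd.
have zx : mdist z (u n).1 < d by apply: lt_trans zn _; lra.
have := mdist_triangle_mid (f z) (f (u n).1) (f (u n).2).
have := dP _ zx; have := dP _ zy; rewrite /= (mdistC _ (f z)); lra.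
Qed.

Lemma hyperextension_continuous : continuous (hyperextension f_continuous).
Proof.
move=> A W /nbhs_ballP[e /= e0 eW].
have [d d0 dP] := compact_uniform_continuity (@cset_compact _ _ A) (e := e / 2) ltac:(lra).
apply/nbhs_ballP; exists d => // B; rewrite ballEmdist /= => AB.
apply: eW; rewrite ballEmdist /=.
apply: (@le_lt_trans _ _ (e / 2)); last by lra.
apply: dH_le => _ [x Cx <-].
  have [y By xy] := dH_lt AB Cx; exists (f y); first by exists y.
  exact: dP.
rewrite mdistC in AB.
have [y By xy] := dH_lt AB Cx; exists (f y); first by exists y.
by rewrite mdistC; apply: dP => //; rewrite mdistC.
Qed.

End hyperextension_continuity.

(** * Cuts of fuzzy sets under the Zadeh extension *)

Section cuts.
Context {R : realType} {X : metricType R}.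
Implicit Types (u v : fuzzy_set X) (A : compact_set X).

Lemma unit_interval0 : unit_interval R 0.
Proof. by apply/unit_intervalP; rewrite lexx ler01. Qed.

Definition alpha_cut u a (Ia : unit_interval R a) : compact_set X :=
  let: conj a0 a1 := andP ((unit_intervalP a).1 Ia) in
  CompactSet (level_fuzzy_compact (u := u) a0) (level_fuzzy_neq0 u a0 a1).

Lemma alpha_cutE u a (Ia : unit_interval R a) :
  cset (alpha_cut u Ia) = level u a.
Proof. by rewrite /alpha_cut; case: (andP _). Qed.

Lemma alpha_cut_distE u v a (Ia : unit_interval R a) :
  mdist (alpha_cut u Ia) (alpha_cut v Ia) = level_dist u v a.
Proof. by rewrite /mdist/= /dH !alpha_cutE. Qed.

(** A description of the levels that covers height 0 without a special case. *)
Lemma levelP u a x : 0 <= a -> level u a x <-> level u 0 x /\ a <= u x.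
Proof.
rewrite le_eqVlt => /predU1P[<-|a0].
  by split=> [|[]//]; split=> //; exact: fuzzy_ge0.
split=> [ux|[_ ax]]; last by rewrite level_gt0.
split; first by apply: level_le ux => //; exact: ltW.
by move: ux; rewrite level_gt0.
Qed.

Section crisp.
Variable A : compact_set X.

Let closedA : closed (cset A).
Proof. by apply: compact_closed; [exact: metric_hausdorff|exact: cset_compact]. Qed.

Lemma level_indic a : unit_interval R a ->
  level (\1_(cset A) : X -> R) a = cset A.
Proof.
move=> /unit_intervalP/andP[]; rewrite le_eqVlt => /predU1P[<- _|a0 a1].
  rewrite level0 [RHS](closure_id _).1//; congr closure; apply/seteqP; split=> x /=.
    by rewrite indicE; have [/set_mem//|_] := boolP (x \in cset A); rewrite ltxx.
  by move=> Ax; rewrite indicE mem_set.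
rewrite level_gt0//; apply/seteqP; split=> x /=; rewrite indicE.
  by have [/set_mem//|_] := boolP (x \in cset A); rewrite leNgt a0.
by move=> Ax; rewrite mem_set.
Qed.

Lemma crisp_exists : exists u, forall a, unit_interval R a -> level u a = cset A.
Proof.
pose u : X -> R := \1_(cset A).
have uI x : unit_interval R (u x).
  by apply/unit_intervalP; rewrite /u indicE; case: (_ \in _); rewrite lexx ler01.
have uusc : upper_semicontinuous u.
  apply: usc_of_levels => // a a0; have [a1|a1] := lerP a 1.
    rewrite -level_gt0// level_indic//; apply/unit_intervalP; rewrite a1; lra.
  rewrite (_ : [set x | a <= u x] = set0); first exact: closed0.
  by rewrite -subset0 => x /=; have /unit_intervalP/andP[_ ] := uI x; lra.
have usupp : compact (level u 0).
  by rewrite level_indic; [exact: cset_compact|exact: unit_interval0].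
have u1 : level u 1 !=set0.
  rewrite level_indic; first exact: cset_neq0.
  by apply/unit_intervalP; rewrite ler01 lexx.
by exists (FuzzySet uI uusc usupp u1) => a /level_indic.
Qed.

End crisp.

Variable f : X -> X.
Hypothesis f_continuous : continuous f.
Local Notation zadehf := (zadeh f_continuous).
Local Notation fbar := (hyperextension f_continuous).

Lemma zadeh_level0 u : level (zadehf u) 0 = f @` level u 0.
Proof.
have im_closed : closed (f @` level u 0).
  apply: compact_closed; first exact: metric_hausdorff.
  apply: continuous_compact; last exact: fuzzy_support.
  exact: continuous_subspaceT.
apply/seteqP; split.
  rewrite [X in _ `<=` X](closure_id _).1// [level (zadehf u) 0]level0.
  apply: closureS => x /= x0.
  have : level (zadehf u) (zadehf u x) x by rewrite level_gt0 /=.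
  rewrite zadeh_level// => -[y uy fy]; exists y => //.
  by apply: level_le uy => //; exact: ltW.
move=> _ [y + <-]; rewrite !level0 => cly W /f_continuous fW.
have [z [/= uz Wz]] := cly _ fW; exists (f z); split => //=.
suff : level (zadehf u) (u z) (f z) by rewrite level_gt0//; exact: lt_le_trans.
by rewrite zadeh_level//; exists z => //; rewrite level_gt0 /=.
Qed.

Lemma alpha_cut_zadeh u a (Ia : unit_interval R a) :
  alpha_cut (zadehf u) Ia = fbar (alpha_cut u Ia).
Proof.
apply: compact_set_eq; rewrite /= !alpha_cutE.
have /unit_intervalP/andP[] := Ia; rewrite le_eqVlt => /predU1P[<- _|a0 _].
  exact: zadeh_level0.
exact: zadeh_level.
Qed.

Lemma alpha_cut_iter_zadeh n u a (Ia : unit_interval R a) :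
  alpha_cut (iter n zadehf u) Ia = iter n fbar (alpha_cut u Ia).
Proof. by elim: n => //= n IH; rewrite alpha_cut_zadeh IH. Qed.

(** What the three systems of fuzzy sets have in common.  [C A] is the
characteristic function of [A], and [good eta] is the set of heights at which
the cuts of the fuzzy sets near [C A] are [eta]-close to [A]; the last hypothesis
says that these heights suffice to see that two fuzzy sets are far apart. *)
Theorem CD_LYC_hyperspace_of_fuzzy (Y : metricType R) (F : Y -> fuzzy_set X)
    (C : compact_set X -> Y) (g : Y -> Y) (good : R -> R -> Prop) :
  metric_complete X ->
  (forall y, F (g y) = zadehf (F y)) ->
  (forall y z, mdist (alpha_cut (F y) unit_interval0)
     (alpha_cut (F z) unit_interval0) <= mdist y z) ->
  (forall eta, 0 < eta -> eta < 1 -> good eta 0) ->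
  (forall A eta, 0 < eta -> exists2 d : R, 0 < d & forall y, mdist (C A) y < d ->
     forall a (Ia : unit_interval R a), good eta a ->
       mdist A (alpha_cut (F y) Ia) < eta) ->
  (forall (eta e : R) y z, 0 < eta -> eta < 1 -> eta < e -> e < mdist y z ->
     exists a (Ia : unit_interval R a), good eta a /\
       e <= mdist (alpha_cut (F y) Ia) (alpha_cut (F z) Ia)) ->
  CD_LYC Y g -> CD_LYC (compact_set X) fbar.
Proof.
move=> Xc FE supp_le good0 near_crisp far_cut [e e0 chaos].
have FitE n y : F (iter n g y) = iter n zadehf (F y).
  by elim: n => //= n IH; rewrite FE IH.
(* A Li-Yorke pair of fuzzy sets whose good cuts lie in [U] and [V].  The
   second Cantor set has two points, one of which differs from [y1]. *)
have pairs U V : nonempty_open U -> nonempty_open V -> exists (eta : R) y z,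
    [/\ 0 < eta, eta < 1, eta < e / 2,
      forall a (Ia : unit_interval R a), good eta a ->
        U (alpha_cut (F y) Ia) /\ V (alpha_cut (F z) Ia) &
      scrambled g e [set y; z] /\ y <> z].
  move=> [oU [A UA]] [oV [B VB]].
  have /nbhs_ballP[dU /= dU0 AU] : nbhs A U by exact: open_nbhs_nbhs.
  have /nbhs_ballP[dV /= dV0 BV] : nbhs B V by exact: open_nbhs_nbhs.
  pose eta := Num.min (Num.min dU dV) (Num.min (1 / 2) (e / 4)).
  have [eta0 etaU etaV eta1 etae] :
      [/\ 0 < eta, eta <= dU, eta <= dV, eta <= 1 / 2 & eta <= e / 4].
    have h0 : 0 < (1 / 2 : R) by lra.
    have h1 : 0 < e / 4 by lra.
    split; rewrite /eta ?lt_min ?dU0 ?dV0 ?h0 ?h1// !ge_min lexx ?orbT//.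
  have [dA dA0 Anear] := near_crisp A eta eta0.
  have [dB dB0 Bnear] := near_crisp B eta eta0.
  pose W j := if j == 0%N then ball (C A) dA else ball (C B) dB.
  have oW j : nonempty_open (W j).
    by rewrite /W; case: eqP => _; exact: nonempty_open_ball.
  have [K [Kc KW KS]] := chaos W (fun j => (oW j).1) (fun j => (oW j).2).
  have [y1 [_ [Ky1 _ _]]] := cantor_set_two_points (Kc 0%N).
  have [z1 [z2 [Kz1 Kz2 z12]]] := cantor_set_two_points (Kc 1%N).
  have [z Kz yz] : exists2 z, K 1%N z & y1 <> z.
    have [y1z1|] := pselect (y1 = z1); last by exists z1.
    by exists z2 => //; rewrite y1z1.
  exists eta, y1, z; split => //; [lra|lra| |].
    move=> a Ia ga; split; [apply: AU|apply: BV]; rewrite ballEmdist /=.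
      apply: lt_le_trans etaU; apply: Anear => //.
      by have := KW 0%N _ Ky1; rewrite /W /= ballEmdist.
    apply: lt_le_trans etaV; apply: Bnear => //.
    by have := KW 1%N _ Kz; rewrite /W /= ballEmdist.
  split => // x w [] -> [] -> //; move=> xw; apply: KS => //;
    by [exists 0%N|exists 1%N].
have limits y z : scrambled g e [set y; z] -> y <> z ->
    (e%:E <= limn_esup (fun n => (mdist (iter n g y) (iter n g z))%:E))%E /\
    limn_einf (fun n => (mdist (iter n g y) (iter n g z))%:E) = 0%E.
  by move=> yzS yz; apply: yzS => //; [left|right].
apply: (@frequently_near_far_CD_LYC _ _ _ _ (e / 3)); first 1 last.
- exact: metric_complete_hyperspace.
- lra.
- move=> U V oU oV d N d0; have [eta [y [z [eta0 eta1 _ UV [S yz]]]]] := pairs _ _ oU oV.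
  have [Uy Vz] := UV _ unit_interval0 (good0 _ eta0 eta1).
  have [_ /limn_einf_eq0P] := limits _ _ S yz.
  move=> /(_ (fun n => mdist_ge0 _ _) d N d0)[n Nn yzd].
  exists (alpha_cut (F y) unit_interval0), (alpha_cut (F z) unit_interval0); split => //.
  exists n => //; rewrite -!alpha_cut_iter_zadeh -!FitE.
  exact: le_lt_trans (supp_le _ _) yzd.
- move=> U V oU oV N; have [eta [y [z [eta0 eta1 etae UV [S yz]]]]] := pairs _ _ oU oV.
  have [/le_limn_esupP/(_ (e / 2) N ltac:(lra))[n Nn eyz] _] := limits _ _ S yz.
  have [a [Ia [ga ea]]] := far_cut _ _ _ _ eta0 eta1 etae eyz.
  have [Uy Vz] := UV _ Ia ga.
  exists (alpha_cut (F y) Ia), (alpha_cut (F z) Ia); split => //.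
  exists n => //; rewrite -!alpha_cut_iter_zadeh -!FitE.
  by apply: lt_le_trans ea; lra.
- exact: hyperextension_continuous.
Qed.

End cuts.

(** * Cuts and the three distances between fuzzy sets *)

Section fuzzy_distances.
Context {R : realType} {X : metricType R}.
Implicit Types (u v : fuzzy_set X) (A : compact_set X).
Local Notation I := (unit_interval R).

Definition crisp A : fuzzy_set X := projT1 (cid (crisp_exists A)).

Lemma level_crisp A a : I a -> level (crisp A) a = cset A.
Proof. exact: (projT2 (cid (crisp_exists A))). Qed.

Lemma alpha_cut_crisp A a (Ia : I a) : alpha_cut (crisp A) Ia = A.
Proof. by apply: compact_set_eq; rewrite alpha_cutE level_crisp. Qed.

Lemma alpha_cut_dist_sup u v a (Ia : I a) :
  mdist (alpha_cut u Ia) (alpha_cut v Ia) <= dist_sup u v.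
Proof. by rewrite alpha_cut_distE; exact: (dist_sup_le u v _).1. Qed.

Lemma dist_sup_attained u v e : e < dist_sup u v ->
  exists a (Ia : I a), e <= mdist (alpha_cut u Ia) (alpha_cut v Ia).
Proof.
move=> euv; apply: contrapT => noa; move: euv; apply/negP; rewrite -leNgt.
apply/dist_sup_le => a Ia; rewrite -(alpha_cut_distE u v Ia) leNgt; apply/negP => ea.
by apply: noa; exists a, Ia; exact: ltW.
Qed.

Lemma skorokhod_id u v e : 0 < e -> dist_sup u v <= e ->
  0 < e /\ exists xi, [/\ incr_homeomorphism xi,
    sup [set `|xi a - a| | a in I] <= e & dist_sup u (xi \o v) <= e].
Proof.
move=> e0 uve; split=> //; exists id; split => //.
  exact: incr_homeomorphism_id.
by apply/dist_id_le => [|a _]; [exact: incr_homeomorphism_id|rewrite subrr normr0 ltW].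
Qed.

Lemma dist_skorokhod_le u v e : 0 < e -> dist_sup u v <= e ->
  dist_skorokhod u v <= e.
Proof.
by move=> e0 uve; apply: ge_inf; [exists 0 => x [/ltW]|exact: skorokhod_id].
Qed.

(** Reparametrizing the heights of [v] by [xi] turns the cut of [v] at [a] into
the cut at [xi a]. *)
Lemma dist_skorokhod_lt u v e : dist_skorokhod u v < e ->
  exists2 xi, incr_homeomorphism xi & forall a, I a ->
    hausdorff_dist mdist (level u (xi a)) (level v a) <= e.
Proof.
have S0 : [set e | 0 < e /\ exists xi, [/\ incr_homeomorphism xi,
    sup [set `|xi a - a| | a in I] <= e & dist_sup u (xi \o v) <= e]] !=set0.
  exists (Num.max 1 (dist_sup u v)).
  by apply: skorokhod_id; rewrite ?lt_max ?ltr01// le_max lexx orbT.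
move=> /(inf_lt S0)[d [d0 [xi [xiP _ ud]]] de]; exists xi => // a Ia.
apply: le_trans (ltW de).
exact: (dist_sup_reindex xiP u v d).1.
Qed.

Lemma support_dist_skorokhod u v :
  mdist (alpha_cut u unit_interval0) (alpha_cut v unit_interval0) <=
  dist_skorokhod u v.
Proof.
apply/ler_addgt0Pr => e e0; have [|xi xiP H] := @dist_skorokhod_lt u v
  (dist_skorokhod u v + e); first by rewrite ltrDl.
rewrite alpha_cut_distE; have := H 0 unit_interval0.
by rewrite (incr_homeomorphism0 xiP).
Qed.

Lemma dist_prod_le (p q : X * R) e :
  dist_prod p q <= e <-> mdist p.1 q.1 <= e /\ `|p.2 - q.2| <= e.
Proof. by rewrite /dist_prod ge_max; split=> /andP. Qed.

Lemma dist_prod_lt (p q : X * R) e :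
  dist_prod p q < e <-> mdist p.1 q.1 < e /\ `|p.2 - q.2| < e.
Proof. by rewrite /dist_prod gt_max; split=> /andP. Qed.

Lemma dist_send_leP u v e : dist_send u v <= e <-> forall r, e < r ->
  (forall p, send u p -> exists2 q, send v q & dist_prod p q < r) /\
  (forall q, send v q -> exists2 p, send u p & dist_prod q p < r).
Proof.
have send0 (w : fuzzy_set X) : send w !=set0.
  have [x wx] := level_fuzzy_neq0 w (lexx 0) ler01.
  by exists (x, 0); split => //=; [exact: unit_interval0|exact: fuzzy_ge0].
have send_bounded (w : fuzzy_set X) : dbounded dist_prod (send w).
  have [p [M pM]] := fuzzy_support_dbounded w.
  exists (p, 0), (Num.max M 1) => -[x a] [/= wx /unit_intervalP/andP[a0 a1] _].
  apply/dist_prod_le => /=; rewrite sub0r normrN ger0_norm// !le_max a1 orbT.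
  by rewrite pM.
apply: hausdorff_dist_le => // [p|p q|q p r].
- by rewrite /dist_prod mdistxx subrr normr0 maxxx.
- by rewrite /dist_prod mdistC distrC.
- apply/dist_prod_le; split.
    apply: le_trans (mdist_triangle_mid q.1 _ _) _.
    by rewrite lerD// /dist_prod le_max lexx.
  apply: le_trans (ler_distD q.2 _ _) _.
  by rewrite lerD// /dist_prod le_max lexx orbT.
Qed.

Lemma dist_sendC u v : dist_send u v = dist_send v u.
Proof. exact: hausdorff_distC. Qed.

Lemma dist_send_lt u v e : dist_send u v < e -> forall p, send u p ->
  exists2 q, send v q & dist_prod p q < e.
Proof. by move=> uve p; have [+ _] := (dist_send_leP u v _).1 (lexx _) _ uve; exact. Qed.

Lemma send_support u x : level u 0 x -> send u (x, 0).
Proof. by move=> ux; split => //=; [exact: unit_interval0|exact: fuzzy_ge0]. Qed.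

Lemma support_dist_send u v :
  mdist (alpha_cut u unit_interval0) (alpha_cut v unit_interval0) <=
  dist_send u v.
Proof.
have half (w1 w2 : fuzzy_set X) (r : R) : dist_send w1 w2 < r ->
    forall x, cset (alpha_cut w1 unit_interval0) x ->
    exists2 y, cset (alpha_cut w2 unit_interval0) y & mdist x y < r.
  move=> wr x; rewrite !alpha_cutE => /send_support wx.
  have [q [q1 _ _] /dist_prod_lt[xq _]] := dist_send_lt wr wx.
  by exists q.1.
apply/dH_leP => r uvr; split; first exact: half.
by apply: half; rewrite dist_sendC.
Qed.

(** The endograph of the characteristic function contains [(x, 1)] for each [x]
in [A], so [u] takes a value above [1 - eta] close to [x].  The cuts of [u] above
that height may miss large parts of [A]. *)
Lemma dist_send_crisp A u (eta : R) a (Ia : I a) :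
  dist_send (crisp A) u < eta -> a <= 1 - eta -> mdist A (alpha_cut u Ia) <= eta.
Proof.
move=> Au aeta; have /unit_intervalP/andP[a0 a1] := Ia.
have I1 : I 1 by apply/unit_intervalP; rewrite ler01 lexx.
apply: dH_le => [x Ax|y]; rewrite alpha_cutE.
  have crispx : level (crisp A) 1 x by rewrite level_crisp.
  have [|q [q1 _ q2] /dist_prod_lt[/= xq]] := dist_send_lt Au (p := (x, 1)).
    have [x0 x1] := (levelP (crisp A) x ler01).1 crispx.
    by split.
  rewrite ltr_norml => /andP[_ qeta]; exists q.1 => //.
  by apply/levelP => //; split => //; lra.
move=> /(levelP u y a0)[/send_support uy _].
rewrite dist_sendC in Au.
have [q [q1 _ _] /dist_prod_lt[/= yq _]] := dist_send_lt Au uy.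
exists q.1 => //; rewrite level_crisp// in q1.
exact: unit_interval0.
Qed.

(** Lowering a point of an endograph to the height [1 - eta] costs at most [eta],
which is less than [e]; hence if the cuts up to this height are all closer than
[e], then so are the endographs. *)
Lemma dist_send_attained u v (eta e : R) : 0 < eta -> eta < 1 -> eta < e ->
  e < dist_send u v -> exists a (Ia : I a), a <= 1 - eta /\
    e <= mdist (alpha_cut u Ia) (alpha_cut v Ia).
Proof.
move=> eta0 eta1 etae euv; apply: contrapT => noa.
have near_cuts a (Ia : I a) : a <= 1 - eta ->
    mdist (alpha_cut u Ia) (alpha_cut v Ia) < e.
  move=> aeta; rewrite ltNge; apply/negP => ea.
  by apply: noa; exists a, Ia.
move: euv; apply/negP; rewrite -leNgt; apply/dist_send_leP => r er.
have half (w1 w2 : fuzzy_set X) :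
    (forall a (Ia : I a), a <= 1 - eta ->
      mdist (alpha_cut w1 Ia) (alpha_cut w2 Ia) < e) ->
    forall p, send w1 p -> exists2 q, send w2 q & dist_prod p q < r.
  move=> w12 [x b] [/= x0 /unit_intervalP/andP[b0 b1] bx].
  pose a := Num.min b (1 - eta).
  have [a0 ab aeta bae] : [/\ 0 <= a, a <= b, a <= 1 - eta & b - a <= eta].
    by rewrite /a; case: (leP b (1 - eta)) => ?; split; lra.
  have Ia : I a by apply/unit_intervalP; rewrite a0; lra.
  have xa : cset (alpha_cut w1 Ia) x.
    by rewrite alpha_cutE; apply/levelP => //; split => //; exact: le_trans bx.
  have [y] := dH_lt (w12 _ Ia aeta) xa.
  rewrite alpha_cutE => /(levelP w2 y a0)[y0 ay] xy.
  exists (y, a); first by split.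
  by apply/dist_prod_lt => /=; split; [lra|rewrite ger0_norm; lra].
split; first exact: half.
by apply: half => a Ia aeta; rewrite mdistC; exact: near_cuts.
Qed.

End fuzzy_distances.

Theorem theorem5p2 (R : realType) (X : metricType R) (f : X -> X)
  (X_complete : metric_complete X)
  (f_continuous : continuous f) :
  CD_LYC (fuzzy_infty X) (zadeh f_continuous) \/
  CD_LYC (fuzzy_skorokhod X) (zadeh f_continuous) \/
  CD_LYC (fuzzy_send X) (zadeh f_continuous) ->
  CD_LYC (compact_set X) (hyperextension f_continuous).
Proof.
have half0 (eta : R) : 0 < eta -> 0 < eta / 2 by lra.
have half_lt (eta : R) : 0 < eta -> eta / 2 < eta by lra.
case=> [|[]].
- apply: (@CD_LYC_hyperspace_of_fuzzy _ _ _ f_continuous (fuzzy_infty X) id crisp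
    (zadeh f_continuous) (fun _ _ => True)) => //.
  + by move=> u v; exact: alpha_cut_dist_sup.
  + move=> A eta eta0; exists eta => // u Au a Ia _.
    apply: le_lt_trans Au; rewrite -{1}(alpha_cut_crisp A Ia).
    exact: alpha_cut_dist_sup.
  + move=> eta e u v _ _ _ /dist_sup_attained[a [Ia ea]].
    by exists a, Ia.
- apply: (@CD_LYC_hyperspace_of_fuzzy _ _ _ f_continuous (fuzzy_skorokhod X) id crisp
    (zadeh f_continuous) (fun _ _ => True)) => //.
  + exact: support_dist_skorokhod.
  + move=> A eta eta0; exists (eta / 2); first exact: half0.
    move=> u /dist_skorokhod_lt[xi xiP H] a Ia _.
    apply: le_lt_trans (half_lt _ eta0).
    have := H a Ia; rewrite level_crisp; last exact: incr_homeomorphism_unit.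
    by rewrite /mdist/= /dH alpha_cutE.
  + move=> eta e u v eta0 _ etae euv.
    have e0 : 0 < e by exact: lt_trans etae.
    have [|a [Ia ea]] := @dist_sup_attained _ _ u v e; last by exists a, Ia.
    rewrite ltNge; apply/negP => /(dist_skorokhod_le e0).
    by rewrite leNgt => /negP; exact.
- apply: (@CD_LYC_hyperspace_of_fuzzy _ _ _ f_continuous (fuzzy_send X) id crisp
    (zadeh f_continuous) (fun eta a => a <= 1 - eta)) => //.
  + exact: support_dist_send.
  + by move=> eta _ /ltW; rewrite subr_ge0.
  + move=> A eta eta0; exists (eta / 2); first exact: half0.
    move=> u Au a Ia aeta; apply: le_lt_trans (half_lt _ eta0).
    by apply: dist_send_crisp => //; lra.
  + by move=> eta e u v; exact: dist_send_attained.
Qed.
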